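(* Let $d=1$, assume (A1), (A2), (ND) for a ground state $u_g$, and (R). Then there exists $\delta_0>0$ such that for every $u(0)\in U_{\delta_0}(u_g)\cap\mathcal S_{p+1}$ the solution of the normalized gradient flow satisfies $$\|u(t)-u_g\|_{H^1}\le Ce^{-at}\qquad\forall t>0,$$ with constants $C,a>0$ independent of $t$.
   Context: Real-valued functions; $d=1$. $\Omega\subset\mathbb R$ a bounded interval with homogeneous Dirichlet or periodic boundary conditions; $X=H^1(\Omega)$ with these conditions; $\langle\cdot,\cdot\rangle$ the $L^2$ inner product. (A1): $1<p<\infty$, $V\in L^\infty(\Omega)$, $V\ge0$. $\lambda_0:=\inf\{\frac12\|u'\|_{L^2}^2+\int_\Omega V|u|^2:u\in X,\|u\|_{L^2}=1\}$; (A2): $\omega>-\lambda_0$. $Q(u)=\frac12\|u'\|_{L^2}^2+\int_\Omega V|u|^2+\omega\|u\|_{L^2}^2$, $\mathcal A=-\frac12\partial_{xx}+V+\omega$, $\mathcal S_{p+1}=\{u\in X:\|u\|_{L^{p+1}}=1\}$. Ground state $u_g\in\arg\min\{Q(u):u\in\mathcal S_{p+1}\}$, with $\mathcal Au_g=\lambda_g|u_g|^{p-1}u_g$, $\lambda_g=Q(u_g)$; $\mathcal T_{u_g}=\{\xi\in X:\langle|u_g|^{p-1}u_g,\xi\rangle=0\}$. (ND): there is $c>0$ with $\langle\mathcal A\xi,\xi\rangle-p\lambda_g\langle|u_g|^{p-1}\xi,\xi\rangle\ge c\|\xi\|_{H^1}^2$ for all $\xi\in\mathcal T_{u_g}$.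 $U_\delta(u_g)=\{u\in X:\|u-u_g\|_{H^1}\le\delta\}$. Normalized gradient flow: $\partial_tu=-\mathcal Au+\lambda(u)|u|^{p-1}u$, $t\ge0$, with $\lambda(u)=\langle\mathcal Au,|u|^{p-1}u\rangle/\|u\|_{L^{2p}}^{2p}$; along it $\|u(t)\|_{L^{p+1}}$ is constant and $\frac{d}{dt}Q(u(t))=-2\|\partial_tu(t)\|_{L^2}^2\le0$. (R): the flow admits a unique global solution $u\in C([0,\infty);H^1(\Omega))\cap C^1((0,\infty);H^1(\Omega))$. *)

(* Defs.v *)
From HB Require Import structures.
From mathcomp Require Import all_boot all_order all_algebra.
From mathcomp Require Import all_classical all_reals all_analysis.
Set Implicit Arguments. Unset Strict Implicit. Unset Printing Implicit Defensive.
Import Order.TTheory GRing.Theory Num.Theory.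
Import numFieldNormedType.Exports.
Local Open Scope classical_set_scope.
Local Open Scope ring_scope.

Inductive bcond := Dirichlet | Periodic.

Section Defs.
Variable R : realType.
Notation mu := (@lebesgue_measure R).

(* closed interval [a,b] (the closure of Omega; endpoints are null sets) *)
Definition Om (a b : R) : set R := `[a, b]%classic.

Definition memL2 (a b : R) (f : R -> R) : Prop :=
  measurable_fun (Om a b) f /\
  (\int[mu]_(x in Om a b) ((f x) ^+ 2)%:E < +oo)%E.

Definition ip (a b : R) (f g : R -> R) : R :=
  Rintegral mu (Om a b) (fun x => f x * g x).

(* g is the (weak) derivative of u on Omega: g in L^2 and u is its primitive,
   i.e. u is absolutely continuous with u' = g a.e.  (1D characterization of H^1) *)
Definition weak_der (a b : R) (u g : R -> R) : Prop :=
  memL2 a b u /\ memL2 a b g /\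
  forall x, a <= x <= b -> u x = u a + Rintegral mu `[a, x]%classic g.

Definition inX (bc : bcond) (a b : R) (u g : R -> R) : Prop :=
  weak_der a b u g /\
  match bc with
  | Dirichlet => u a = 0 /\ u b = 0
  | Periodic => u a = u b
  end.

Definition H1sq (a b : R) (u g : R -> R) : R := ip a b u u + ip a b g g.

Definition nl (p : R) (s : R) : R := `|s| `^ (p - 1) * s.

Definition intpow (a b : R) (q : R) (u : R -> R) : R :=
  Rintegral mu (Om a b) (fun x => `|u x| `^ q).

Definition onS (a b p : R) (u : R -> R) : Prop := intpow a b (p + 1) u = 1.

Definition Q0 (a b : R) (V : R -> R) (u g : R -> R) : R :=
  2^-1 * ip a b g g + ip a b (fun x => V x * u x) u.

Definition Qf (a b : R) (V : R -> R) (om : R) (u g : R -> R) : R :=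
  Q0 a b V u g + om * ip a b u u.

Definition lambda0 (bc : bcond) (a b : R) (V : R -> R) : R :=
  inf [set r : R | exists u g : R -> R,
          inX bc a b u g /\ ip a b u u = 1 /\ r = Q0 a b V u g].

Definition Aform (a b : R) (V : R -> R) (om : R) (u u' v v' : R -> R) : R :=
  2^-1 * ip a b u' v' + ip a b (fun x => V x * u x) v + om * ip a b u v.

(* lambda(u) = <A u, |u|^{p-1}u> / ||u||_{L^{2p}}^{2p};
   the derivative of |u|^{p-1}u is p |u|^{p-1} u'. *)
Definition lam (a b : R) (V : R -> R) (om p : R) (u u' : R -> R) : R :=
  Aform a b V om u u' (fun x => nl p (u x)) (fun x => p * `|u x| `^ (p - 1) * u' x)
  / intpow a b (2 * p) u.

(* A solution on [0,oo) of the normalized gradient flow: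
   u t = u(t), ux t = its spatial derivative; w t = d/dt u(t) (in H^1), wx t its derivative.
   u in C([0,oo);H^1) /\ C^1((0,oo);H^1), and the equation holds in the weak (X-dual) sense. *)
Definition flow_solution (bc : bcond) (a b : R) (V : R -> R) (om p : R)
    (u ux : R -> R -> R) : Prop :=
  (forall t, 0 <= t -> inX bc a b (u t) (ux t)) /\
  (forall t, 0 <= t -> forall e, 0 < e -> exists d, 0 < d /\
     forall s, 0 <= s -> `|s - t| < d ->
       H1sq a b (fun x => u s x - u t x) (fun x => ux s x - ux t x) < e) /\
  exists w wx : R -> R -> R,
    (forall t, 0 < t -> inX bc a b (w t) (wx t)) /\
    (forall t, 0 < t -> forall e, 0 < e -> exists d, 0 < d /\
       forall s, 0 < s -> `|s - t| < d -> s != t ->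
         H1sq a b (fun x => (u s x - u t x) / (s - t) - w t x)
                  (fun x => (ux s x - ux t x) / (s - t) - wx t x) < e) /\
    (forall t, 0 < t -> forall e, 0 < e -> exists d, 0 < d /\
       forall s, 0 < s -> `|s - t| < d ->
         H1sq a b (fun x => w s x - w t x) (fun x => wx s x - wx t x) < e) /\
    (forall t, 0 < t -> forall phi phi', inX bc a b phi phi' ->
       ip a b (w t) phi =
         - Aform a b V om (u t) (ux t) phi phi'
         + lam a b V om p (u t) (ux t) * ip a b (fun x => nl p (u t x)) phi).

End Defs.

(* Main.v *)
(** Write [xi = u - ug], [lg = Q(ug)] and [E = Q(u) - lg].  Three local facts on the sphere drive the
    proof.  (i) Taylor expansion of the constraint turns (ND) into [E >= c1 ||xi||^2], because the
    normal component [<nl ug, xi>] is quadratic in [xi].  (ii) [E <= C ||xi||^2] by convexity of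
    [|.|^(p+1)].  (iii) Testing the equation with [xi - <nl u, xi> u], which is tangent at [u],
    eliminates the multiplier and gives [||d_t u||_L2^2 >= c2 ||xi||^2].  Since [E' = -2 ||d_t u||^2],
    (i) and (ii) trap the solution near [ug] by continuity, and then (ii) and (iii) yield
    [E' <= - k E]; (i) converts the decay of [E] into decay of [||xi||].
    The Euler-Lagrange equation of [ug] is derived from minimality, and the conservation of the
    [L^(p+1)] norm from testing with [nl u], which requires the chain rule in [H^1]. *)
Require Import Defs.
From HB Require Import structures.
From mathcomp Require Import all_boot all_order all_algebra.
From mathcomp Require Import all_classical all_reals all_analysis.
From mathcomp Require Import measurable_realfun.
From mathcomp Require Import ring lra.
Import Order.TTheory GRing.Theory Num.Theory.
Import numFieldNormedType.Exports.
Local Open Scope classical_set_scope.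
Local Open Scope ring_scope.

(** Since only [1 < p] is assumed, [nl p] is C^1 and possibly no better, so cubic remainders are out
    of reach. Taylor errors are [eta] times a square, uniformly on bounded sets, and the
    one-dimensional bound of the sup norm by the H^1 norm turns a small H^1 distance into pointwise
    smallness. Put [k = <nl ug, xi>], [T = <|ug|^(p-1) xi, xi>] and [B = Q(xi) - p lg T], the form
    in (ND). The Euler-Lagrange equation gives exactly [E = Q(xi) + 2 lg k], and the constraint
    gives [k >= -(p/2) T] up to a small multiple of [||xi||^2]; hence [E >= B] up to a small error.
    Pairing the velocity with the test function of (iii) produces [B] again, so (ND) yields both the
    energy gap and the slope. As [xi] is tangent at [ug] only up to a quadratic error, (ND) is
    applied to [xi - k ug]. Elements of H^1 are pairs of a function and its derivative, and norms
    stay squared to avoid roots. *)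

(** * Calculus of the power nonlinearity on the real line *)

Section RealFunctions.
Variable R : realType.
Implicit Types (p s h x : R) (f df : R -> R).

Lemma absr_powR_continuous (q : R) : 0 < q -> continuous (fun s : R => `|s| `^ q).
Proof.
move=> q0 s; have [->|s0] := eqVneq s 0.
  apply/cvgrPdist_lt => e e0; rewrite normr0 powR0 ?gt_eqF//.
  near=> x; rewrite sub0r normrN ger0_norm ?powR_ge0//.
  have -> : e = (e `^ q^-1) `^ q by rewrite -powRrM mulVf ?gt_eqF// powRr1// ltW.
  apply: gt0_ltr_powR => //; rewrite ?nnegrE ?powR_ge0//.
  near: x; have := @nbhs0_lt R R (e `^ q^-1); apply; exact: powR_gt0.
apply: (@continuous_comp _ _ _ (fun x : R => `|x|) (fun x : R => x `^ q)).
  exact: norm_continuous.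
apply: differentiable_continuous; apply/derivable1_diffP.
by apply: derivable_powR; rewrite in_itv/= andbT normr_gt0.
Unshelve. all: by end_near. Qed.

Lemma nlN p s : nl p (- s) = - nl p s.
Proof. by rewrite /nl normrN mulrN. Qed.

Lemma absr_powRM p s : 1 < p -> nl p s * s = `|s| `^ (p + 1).
Proof.
move=> hp; rewrite /nl -mulrA -expr2 -real_normK ?num_real// expr2 mulrA.
rewrite (mulrC (`|s| `^ _)) mulr_powRB1//; last by lra.
rewrite -(mulr_powRB1 (normr_ge0 s) (_ : 0 < p + 1)); last by lra.
by rewrite addrK mulrC.
Qed.

(** On positive reals [nl p] is the power [p], and oddness transfers this to negative reals. At 0
    the difference quotient is [|h|^(p-1)], which tends to 0 because [p > 1]. *)
Lemma is_derive_nl p s : 1 < p -> is_derive s 1 (nl p) (p * `|s| `^ (p - 1)).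
Proof.
move=> hp.
have pos (x : R) : 0 < x -> is_derive x 1 (nl p) (p * `|x| `^ (p - 1)).
  move=> x0; rewrite (gtr0_norm x0).
  apply: (@near_eq_is_derive _ _ _ (fun y => y `^ p)) => //.
  - near=> y.
    have y0 : 0 < y by near: y; exact: lt_nbhsr.
    by rewrite /nl gtr0_norm// mulrC mulr_powRB1 ?ltW//; lra.
  - exact: is_derive1_powR.
have [s0|s0|->] := ltgtP s 0; last 2 first.
- exact: pos.
- rewrite normr0 powR0 ?mulr0 ?subr_eq0 ?gt_eqF//.
  have hc : h^-1 *: (nl p (h *: 1 + 0) - nl p 0) @[h --> (0:R)^'] --> (0:R).
    have := @absr_powR_continuous (p - 1) _ 0; rewrite subr_gt0 => /(_ hp).
    rewrite /continuous_at normr0 powR0 ?subr_eq0 ?gt_eqF// => h0.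
    have h1 : `|s| `^ (p - 1) @[s --> (0:R)^'] --> (0:R) by exact: cvg_within_filter h0.
    apply: cvg_trans h1.
    apply: near_eq_cvg; near=> h.
    have hn : h != 0 by near: h; exact: nbhs_dnbhs_neq.
    rewrite /nl mulr0 subr0 addr0 /GRing.scale/= mulr1 mulrCA mulVf//.
    by rewrite mulr1.
  by split; [apply/cvg_ex; exists 0|apply/cvg_lim].
- have -> : nl p = (fun x => - nl p (- x)) by apply/funext => x; rewrite nlN opprK.
  have sp := pos (- s); rewrite oppr_gt0 in sp; have {}sp := sp s0.
  rewrite normrN in sp.
  have h1 : is_derive s (1:R) (fun x : R => - x) (- 1) by exact: is_deriveN.
  have h2 := @is_derive1_comp _ (nl p) (fun x : R => - x) s _ _ sp h1.
  have h3 := is_deriveN h2.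
  by apply: (is_derive_eq h3); rewrite mulrN1 opprK.
Unshelve. all: by end_near. Qed.

Lemma is_derive_absr_powR p s : 1 < p ->
  is_derive s 1 (fun s : R => `|s| `^ (p + 1)) ((p + 1) * nl p s).
Proof.
move=> hp.
have -> : (fun s : R => `|s| `^ (p + 1)) = (nl p * id).
  by apply/funext => x; rewrite -absr_powRM.
have h1 := is_derive_nl p s hp.
have h2 : is_derive s (1:R) id 1 by exact: is_derive_id.
have h3 := is_deriveM h1 h2.
apply: (is_derive_eq h3); rewrite /GRing.scale/= mulr1 /nl; ring.
Qed.

(** Writing the intermediate point as [s + th * h] treats both signs of [h], and [h = 0], at once,
    so the pointwise estimates below need no case split. *)
Lemma MVT_shift f df : (forall x, is_derive x (1:R) f (df x)) ->
  forall s h, exists2 th : R, 0 <= th <= 1 & f (s + h) - f s = df (s + th * h) * h.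
Proof.
move=> fd s h.
have fc A : {within A, continuous f}.
  apply: continuous_subspaceT => x.
  by apply: differentiable_continuous; apply/derivable1_diffP; case: (fd x).
have [h0|h0|->] := ltgtP h 0.
- have [|//|c + E] := @MVT _ f df (s + h) s _ (fun x _ => fd x); first lra.
  rewrite in_itv/= => /andP[c1 c2].
  exists ((c - s) / h).
    rewrite ler_ndivlMr// ler_ndivrMr//; lra.
  rewrite divfK ?lt_eqF// (addrC s (_ - _)) subrK.
  have -> : f (s + h) - f s = - (f s - f (s + h)) by ring.
  rewrite E; ring.
- have [|//|c + E] := @MVT _ f df s (s + h) _ (fun x _ => fd x); first lra.
  rewrite in_itv/= => /andP[c1 c2].
  exists ((c - s) / h).
    rewrite ler_pdivlMr// ler_pdivrMr//; lra.
  rewrite divfK ?gt_eqF// (addrC s (_ - _)) subrK E; ring.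
- by exists 0; [rewrite lexx ler01|rewrite addr0 subrr mulr0].
Qed.

(** The point [s + h] may leave [[- M, M]], so compactness enters in its near-covering form, with
    [h] as parameter, rather than through uniform continuity on the segment. *)
Lemma continuous_unif_on_segment f : continuous f -> forall M eta : R, 0 < eta ->
  exists2 d : R, 0 < d & forall s h, `|s| <= M -> `|h| <= d -> `|f (s + h) - f s| <= eta.
Proof.
move=> fc M eta eta0.
pose P (h s : R) := `|f (s + h) - f s| <= eta.
have : \forall h \near nbhs (0:R), `[- M, M]%classic `<=` P h.
  apply: (iffLR (compact_near_coveringP _) (@segment_compact _ (- M) M) _ (nbhs (0:R)) P).
  move=> x _; rewrite /P.
  have : ((fun z : R * R => f (z.1 + z.2) - f z.1) @ nbhs (x, 0:R)) --> (0:R).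
    have {2}-> : 0 = f (x + 0) - f x by rewrite addr0 subrr.
    apply: cvgB.
      apply: continuous_cvg; first exact: fc.
      by apply: cvgD; [exact: cvg_fst|exact: cvg_snd].
    by apply: continuous_cvg; [exact: fc|exact: cvg_fst].
  move=> /cvgrPdist_le /(_ eta eta0).
  by apply: filterS => z /=; rewrite sub0r normrN.
move=> /nbhs_ballP[d /= d0 hd]; exists (d / 2); first by rewrite divr_gt0.
move=> s h sM hh; apply: hd => /=; last by rewrite in_itv/= -ler_norml.
by rewrite /ball/= sub0r normrN (le_lt_trans hh)// ltr_pdivrMr//; lra.
Qed.

Lemma unif_first_order f df : (forall x, is_derive x (1:R) f (df x)) -> continuous df ->
  forall M eta : R, 0 < eta ->
  exists2 d : R, 0 < d & forall s h, `|s| <= M -> `|h| <= d ->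
    `|f (s + h) - f s - df s * h| <= eta * `|h|.
Proof.
move=> fd dfc M eta eta0.
have [d d0 hd] := continuous_unif_on_segment df dfc M eta eta0.
exists d => // s h sM hh.
have [th /andP[t0 t1] ->] := MVT_shift f df fd s h.
rewrite -mulrBl normrM ler_wpM2r// hd// normrM ger0_norm//.
by rewrite (le_trans _ hh)// ler_piMl.
Qed.

Lemma dnl_continuous p : 1 < p ->
  continuous (fun s : R => p * `|s| `^ (p - 1)).
Proof.
move=> hp s; apply: cvgM; first exact: cvg_cst.
by apply: absr_powR_continuous; rewrite subr_gt0.
Qed.

Lemma nl_continuous p : 1 < p ->
  continuous (nl p).
Proof.
move=> hp x; apply: differentiable_continuous; apply/derivable1_diffP.
by case: (is_derive_nl p x hp).
Qed.

Lemma nl_mono p s h : 1 < p ->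
  0 <= (nl p (s + h) - nl p s) * h.
Proof.
move=> hp; have [th _ ->] := MVT_shift _ _ (fun x => is_derive_nl p x hp) s h.
rewrite -mulrA -expr2; apply: mulr_ge0; last exact: sqr_ge0.
apply: mulr_ge0; [lra|exact: powR_ge0].
Qed.

Lemma nl_lipschitz p (M : R) : 1 < p ->
  exists2 L : R, 0 < L & forall s h, `|s| <= M -> `|h| <= M ->
  `|nl p (s + h) - nl p s| <= L * `|h|.
Proof.
(* The intermediate point has size at most [2 * |M|]; the [+ 1] keeps the constant positive. *)
move=> hp; exists (p * (2 * `|M|) `^ (p - 1) + 1).
  by rewrite ltr_wpDl//; apply: mulr_ge0; [lra|exact: powR_ge0].
move=> s h sM hM.
have [th /andP[t0 t1] ->] := MVT_shift _ _ (fun x => is_derive_nl p x hp) s h.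
rewrite normrM ler_wpM2r//; apply: ler_wpDr => //.
rewrite ger0_norm ?mulr_ge0 ?powR_ge0//; last by lra.
rewrite ler_wpM2l//; first by lra.
apply: ge0_ler_powR; rewrite ?nnegrE//; first by lra.
rewrite (le_trans (ler_normD _ _))// mulr_natl mulr2n lerD//.
  by rewrite (le_trans sM)// ler_norm.
rewrite normrM (ger0_norm t0) (le_trans (_ : _ <= 1 * `|h|))//.
  by rewrite ler_wpM2r.
by rewrite mul1r (le_trans hM)// ler_norm.
Qed.

Lemma absr_powR_convex p s h : 1 < p ->
  `|s| `^ (p + 1) + (p + 1) * nl p s * h <= `|s + h| `^ (p + 1).
Proof.
move=> hp; have [th /andP[t0 t1] E] := MVT_shift _ _ (fun x => is_derive_absr_powR p x hp) s h.
have -> : `|s + h| `^ (p + 1) = `|s| `^ (p + 1) + (p + 1) * nl p (s + th * h) * h.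
  by rewrite -E; ring.
rewrite lerD2l -subr_ge0.
have [->|th0] := eqVneq th 0; first by rewrite mul0r addr0 subrr.
have {}th0 : 0 < th by rewrite lt_neqAle eq_sym th0.
(* Monotonicity is applied to the increment [th * h] of the mean value point, and the factor
   [th > 0] is then divided out. *)
have := nl_mono p s (th * h) hp => mono.
have : 0 <= th * ((nl p (s + th * h) - nl p s) * h) by lra.
rewrite pmulr_rge0// => mn.
rewrite (_ : _ - _ = (p + 1) * ((nl p (s + th * h) - nl p s) * h)); last by ring.
rewrite mulr_ge0//; lra.
Qed.

(** The constant is crude, but the increment may be as large as [M]; this serves to differentiate
    the [L^(p+1)] integral along a curve. *)
Lemma absr_powR_quad p (M : R) : 1 < p ->
  exists2 L : R, 0 < L & forall s h, `|s| <= M -> `|h| <= M ->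
  `|s + h| `^ (p + 1) - `|s| `^ (p + 1) - (p + 1) * nl p s * h <= L * h ^+ 2.
Proof.
move=> hp; have [L L0 hL] := nl_lipschitz p M hp.
exists ((p + 1) * L); first by apply: mulr_gt0; [lra|].
move=> s h sM hM.
have [th /andP[t0 t1] ->] := MVT_shift _ _ (fun x => is_derive_absr_powR p x hp) s h.
rewrite -mulrBl -mulrBr -2!mulrA ler_wpM2l//; first by lra.
have thh : `|th * h| <= `|h|.
  by rewrite normrM (ger0_norm t0) ler_piMl.
have := hL s (th * h) sM (le_trans thh hM) => H.
apply: (le_trans (ler_norm _)).
rewrite normrM -(real_normK (num_real h)) expr2 mulrA ler_wpM2r//.
apply: (le_trans H); rewrite ler_wpM2l// ltW//.
Qed.

(** Here the quadratic coefficient is sharp up to [eta], the price of a second derivative that is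
    merely continuous. On the sphere it bounds [<nl ug, xi>] from below. *)
Lemma absr_powR_second_order p (M eta : R) : 1 < p -> 0 < eta ->
  exists2 d : R, 0 < d & forall s h, `|s| <= M -> `|h| <= d ->
    `|s + h| `^ (p + 1) - `|s| `^ (p + 1) - (p + 1) * nl p s * h
      <= (p + 1) * (p / 2 * `|s| `^ (p - 1) + eta) * h ^+ 2.
Proof.
move=> hp eta0.
have [d d0 hd] := unif_first_order (nl p) (fun s => p * `|s| `^ (p - 1))
  (fun x => is_derive_nl p x hp) (dnl_continuous p hp) M eta eta0.
exists d => // s h sM hh.
pose c := p * `|s| `^ (p - 1).
(* Subtracting the second-order polynomial makes the derivative of [g] equal to [p + 1] times the
   first-order error of [nl p], which [hd] controls; one mean value step then suffices. *)
pose g := fun h => `|s + h| `^ (p + 1) - ((p + 1) * nl p s * h + (p + 1) * c / 2 * h ^+ 2).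
have gd x : is_derive x (1:R) g ((p + 1) * (nl p (s + x) - nl p s - c * x)).
  have h1 : is_derive x (1:R) (fun h => `|s + h| `^ (p + 1)) ((p + 1) * nl p (s + x)).
    have a1 : is_derive x (1:R) (fun h => s + h) 1.
      have a2 := is_deriveD (is_derive_cst s x (1:R)) (is_derive_id x (1:R)).
      by apply: (is_derive_eq a2); rewrite add0r.
    have a3 := @is_derive1_comp _ (fun s => `|s| `^ (p + 1)) (fun h => s + h) x _ _
      (is_derive_absr_powR p (s + x) hp) a1.
    by apply: (is_derive_eq a3); rewrite mulr1.
  have h2 : is_derive x (1:R) (fun h => (p + 1) * nl p s * h + (p + 1) * c / 2 * h ^+ 2)
     ((p + 1) * nl p s + (p + 1) * c * x).
    have b1 := is_deriveZ ((p + 1) * nl p s) (is_derive_id x (1:R)).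
    have b2 := is_deriveZ ((p + 1) * c / 2) (is_deriveX 2 (is_derive_id x (1:R))).
    have b3 := is_deriveD b1 b2.
    have -> : (fun h => (p + 1) * nl p s * h + (p + 1) * c / 2 * h ^+ 2) =
      ((p + 1) * nl p s) \*: id + ((p + 1) * c / 2) \*: (id ^+ 2).
      by apply/funext => y; rewrite /GRing.scale/= fctE/= /GRing.scale/= exprfctE.
    by apply: (is_derive_eq b3); rewrite /GRing.scale/=; field.
  have h3 := is_deriveB h1 h2.
  apply: (is_derive_eq h3); ring.
have [th /andP[t0 t1]] := MVT_shift _ _ gd 0 h; rewrite !add0r => E.
have thh : `|th * h| <= `|h| by rewrite normrM (ger0_norm t0) ler_piMl.
have := hd s (th * h) sM (le_trans thh hh); rewrite -/c => H.
have H2 : (nl p (s + th * h) - nl p s - c * (th * h)) * h <= eta * h ^+ 2.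
  apply: (le_trans (ler_norm _)).
  rewrite normrM -(real_normK (num_real h)) expr2 (mulrA eta) ler_wpM2r//.
  apply: (le_trans H); rewrite ler_wpM2l// ltW//.
have -> : `|s + h| `^ (p + 1) - `|s| `^ (p + 1) - (p + 1) * nl p s * h =
   (g h - g 0) + (p + 1) * c / 2 * h ^+ 2.
  rewrite /g addr0; ring.
rewrite E -mulrA.
have : (p + 1) * ((nl p (s + th * h) - nl p s - c * (th * h)) * h) <= (p + 1) * (eta * h ^+ 2).
  by rewrite ler_wpM2l//; lra.
rewrite /c; lra.
Qed.

End RealFunctions.

(** * Integration on the interval, [L^2] inner products and [H^1] functions *)

Section L2Toolbox.
Variable R : realType.
Notation mu := (@lebesgue_measure R).
Implicit Types (a b c x y t : R) (f g h u v : R -> R).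

Definition integ a b f := mu.-integrable (Om a b) (EFin \o f).

Lemma measurable_Om a b : measurable (Om a b).
Proof. exact: measurable_itv. Qed.

Lemma integ_measurable a b f : integ a b f -> measurable_fun (Om a b) f.
Proof. by move=> /integrableP[/measurable_EFinP]. Qed.

Lemma integ_dominated a b f g : measurable_fun (Om a b) f -> integ a b g ->
  (forall x, a <= x <= b -> `|f x| <= g x) -> integ a b f.
Proof.
move=> mf ig fg; apply: (le_integrable _ _ _ ig) => //.
- exact: measurable_Om.
- exact/measurable_EFinP.
- move=> x; rewrite /Om/= in_itv/= => xab.
  by rewrite lee_fin (le_trans (fg _ xab))// ler_norm.
Qed.

Lemma integD a b f g : integ a b f -> integ a b g -> integ a b (fun x => f x + g x).
Proof. by move=> hf hg; exact: (@integrableD _ _ _ mu (Om a b) (measurable_itv _) _ _ hf hg). Qed.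

Lemma integZ a b c f : integ a b f -> integ a b (fun x => c * f x).
Proof. by move=> hf; exact: (@integrableZl _ _ _ mu (Om a b) (measurable_itv _) c _ hf). Qed.

Lemma integ_cst a b c : integ a b (fun=> c).
Proof.
apply/integrableP; split; first by apply/measurable_EFinP; exact: measurable_cst.
rewrite integral_cst//=; last exact: measurable_Om.
rewrite /Om lebesgue_measure_itv/=; case: ifP => _; last by rewrite mule0 ltry.
by rewrite -EFinB -EFinM ltry.
Qed.

Lemma integ_sub a b x y f : a <= x -> y <= b -> integ a b f -> integ x y f.
Proof.
move=> ax yb; apply: integrableS; try exact: measurable_Om.
move=> z; rewrite /Om/= !in_itv/= => /andP[h1 h2].
by rewrite (le_trans ax h1) (le_trans h2 yb).
Qed.

Lemma Rintegral_ext a b f g : (forall x, a <= x <= b -> f x = g x) ->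
  Rintegral mu (Om a b) f = Rintegral mu (Om a b) g.
Proof.
by move=> fg; apply: eq_Rintegral => x; rewrite inE/= /Om/= in_itv/= => /fg.
Qed.

Lemma Rintegral_mono a b f g : integ a b f -> integ a b g ->
  (forall x, a <= x <= b -> f x <= g x) ->
  Rintegral mu (Om a b) f <= Rintegral mu (Om a b) g.
Proof.
move=> hf hg fg; apply: le_Rintegral => //.
exact: measurable_Om.
Qed.

Lemma Rintegral_nneg a b f : (forall x, a <= x <= b -> 0 <= f x) ->
  0 <= Rintegral mu (Om a b) f.
Proof. by move=> f0; apply: Rintegral_ge0 => x; rewrite /Om/= in_itv/= => /f0. Qed.

Lemma Rintegral_add a b f g : integ a b f -> integ a b g ->
  Rintegral mu (Om a b) (fun x => f x + g x) =
  Rintegral mu (Om a b) f + Rintegral mu (Om a b) g.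
Proof. by move=> hf hg; apply: RintegralD => //; exact: measurable_Om. Qed.

Lemma Rintegral_scale a b c f : integ a b f ->
  Rintegral mu (Om a b) (fun x => c * f x) = c * Rintegral mu (Om a b) f.
Proof. by move=> hf; apply: RintegralZl => //; exact: measurable_Om. Qed.

Lemma Rintegral_const a b c : a <= b -> Rintegral mu (Om a b) (fun=> c) = c * (b - a).
Proof.
move=> ab; rewrite Rintegral_cst; last exact: measurable_Om.
rewrite /Om; have := @lebesgue_measure_itv R `[a, b]; rewrite /= lte_fin => ->.
case: ltP => //= h; have -> : a = b by apply: le_anti; rewrite ab h.
by rewrite subrr.
Qed.

(** Subtracting the two integrals leaves a half-open interval, whose missing endpoint is a null
    set. *)
Lemma Rintegral_cat a b x f : integ a b f -> a <= x -> x <= b ->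
  Rintegral mu (Om a b) f = Rintegral mu (Om a x) f + Rintegral mu (Om x b) f.
Proof.
move=> hf ax xb; apply/eqP; rewrite addrC -subr_eq; apply/eqP.
have := @Rintegral_itvB R f (BLeft a) (BRight b) x hf.
rewrite !bnd_simp => /(_ ax xb); rewrite -/(Om a b) -/(Om a x) => ->.
rewrite Rintegral_itv_obnd_cbnd//.
apply: (integrableS _ _ _ (integ_sub a b x b f ax (lexx b) hf)) => //.
- exact: measurable_Om.
- by move=> z; rewrite /Om/= !in_itv/= => /andP[/ltW -> ->].
Qed.

Lemma Rintegral_subset a b x y f : integ a b f -> a <= x -> x <= y -> y <= b ->
  (forall z, a <= z <= b -> 0 <= f z) ->
  Rintegral mu (Om x y) f <= Rintegral mu (Om a b) f.
Proof.
move=> hf ax xy yb f0.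
rewrite (Rintegral_cat a b x f)//; last exact: le_trans yb.
rewrite (Rintegral_cat x b y f)//; last exact: integ_sub hf.
have h1 : 0 <= Rintegral mu (Om a x) f.
  apply: Rintegral_nneg => z /andP[z1 z2]; apply: f0.
  by rewrite z1 (le_trans z2)// (le_trans xy).
have h2 : 0 <= Rintegral mu (Om y b) f.
  apply: Rintegral_nneg => z /andP[z1 z2]; apply: f0.
  by rewrite z2 (le_trans ax)// (le_trans xy).
by rewrite addrCA lerDl addr_ge0.
Qed.

Lemma memL2_integ_sq a b f : memL2 a b f -> integ a b (fun x => f x ^+ 2).
Proof.
move=> [mf fi]; apply/integrableP; split.
  by apply/measurable_EFinP; exact: measurable_funX.
by under eq_integral do rewrite /= ger0_norm ?sqr_ge0//.
Qed.

Lemma memL2_of_integ_sq a b f : measurable_fun (Om a b) f ->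
  integ a b (fun x => f x ^+ 2) -> memL2 a b f.
Proof.
move=> mf /integrableP[_]; under eq_integral do rewrite /= ger0_norm ?sqr_ge0//.
by move=> fi; split.
Qed.

Lemma memL2_dominated a b f g : measurable_fun (Om a b) f -> memL2 a b g ->
  (forall x, a <= x <= b -> `|f x| <= `|g x|) -> memL2 a b f.
Proof.
move=> mf hg fg; apply: memL2_of_integ_sq => //.
apply: (integ_dominated _ _ _ _ _ (memL2_integ_sq _ _ _ hg)).
  exact: measurable_funX.
move=> x xab; rewrite ger0_norm ?sqr_ge0//.
by rewrite -(real_normK (num_real (f x))) -(real_normK (num_real (g x))) lerXn2r ?nnegrE ?fg.
Qed.

Lemma memL2_integ_mul a b f g : memL2 a b f -> memL2 a b g ->
  integ a b (fun x => f x * g x).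
Proof.
move=> hf hg.
apply: (integ_dominated _ _ _ (fun x => f x ^+ 2 + g x ^+ 2)).
- by apply: measurable_funM; [case: hf|case: hg].
- by apply: integD; exact: memL2_integ_sq.
- move=> x _; rewrite normrM -(real_normK (num_real (f x))) -(real_normK (num_real (g x))).
  have h1 := normr_ge0 (f x); have h2 := normr_ge0 (g x).
  have := sqr_ge0 (`|f x| - `|g x|); nra.
Qed.

Lemma memL2_cst a b c : memL2 a b (fun=> c).
Proof. by apply: memL2_of_integ_sq; [exact: measurable_cst|exact: integ_cst]. Qed.

Lemma memL2_bounded a b (M : R) f : measurable_fun (Om a b) f ->
  (forall x, a <= x <= b -> `|f x| <= M) -> memL2 a b f.
Proof.
move=> mf fM; apply: (memL2_dominated _ _ _ (fun=> M)) => //; first exact: memL2_cst.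
by move=> x /fM h; rewrite (le_trans h)// ler_norm.
Qed.

Lemma memL2Z a b c f : memL2 a b f -> memL2 a b (fun x => c * f x).
Proof.
move=> hf; apply: memL2_of_integ_sq.
  by apply: measurable_funM; [exact: measurable_cst|case: hf].
have -> : (fun x => (c * f x) ^+ 2) = (fun x => c ^+ 2 * f x ^+ 2).
  by apply/funext => x; rewrite exprMn.
by apply: integZ; exact: memL2_integ_sq.
Qed.

Lemma memL2D a b f g : memL2 a b f -> memL2 a b g -> memL2 a b (fun x => f x + g x).
Proof.
move=> hf hg; apply: memL2_of_integ_sq.
  by apply: measurable_funD; [case: hf|case: hg].
have -> : (fun x => (f x + g x) ^+ 2) =
   (fun x => (f x ^+ 2 + 2 * (f x * g x)) + g x ^+ 2).
  by apply/funext => x; ring.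
by apply: integD; [apply: integD; [|apply: integZ; exact: memL2_integ_mul]|];
  exact: memL2_integ_sq.
Qed.

Lemma memL2_bounded_mul a b (M : R) h f : measurable_fun (Om a b) h ->
  (forall x, a <= x <= b -> `|h x| <= M) -> memL2 a b f ->
  memL2 a b (fun x => h x * f x).
Proof.
move=> mh hM hf; apply: (memL2_dominated _ _ _ (fun x => M * f x)).
- by apply: measurable_funM => //; case: hf.
- exact: memL2Z.
- by move=> x /hM H; rewrite !normrM ler_wpM2r// (le_trans H)// ler_norm.
Qed.

Lemma memL2_integ a b f : memL2 a b f -> integ a b f.
Proof.
move=> hf; have := memL2_integ_mul _ _ _ _ hf (memL2_cst a b 1).
by under eq_fun do rewrite mulr1.
Qed.

Lemma memL2_sub a b x y f : a <= x -> y <= b -> memL2 a b f -> memL2 x y f.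
Proof.
move=> ax yb hf; apply: memL2_of_integ_sq.
  exact: integ_measurable (integ_sub _ _ _ _ _ ax yb (memL2_integ _ _ _ hf)).
exact: integ_sub _ _ _ _ _ ax yb (memL2_integ_sq _ _ _ hf).
Qed.

Lemma memL2_abs a b f : memL2 a b f -> memL2 a b (fun x => `|f x|).
Proof.
move=> hf; apply: (memL2_dominated _ _ _ f) => //; last by move=> x; rewrite normr_id.
by apply: measurableT_comp; [exact: normr_measurable|case: hf].
Qed.

Lemma ipC a b f g : ip a b f g = ip a b g f.
Proof. by apply: Rintegral_ext => x _; rewrite mulrC. Qed.

Lemma ip_ext a b f f1 g g1 : (forall x, a <= x <= b -> f x = f1 x) ->
  (forall x, a <= x <= b -> g x = g1 x) -> ip a b f g = ip a b f1 g1.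
Proof. by move=> h1 h2; apply: Rintegral_ext => x xab; rewrite h1 ?h2. Qed.

Lemma ipDl a b f g h : memL2 a b f -> memL2 a b g -> memL2 a b h ->
  ip a b (fun x => f x + g x) h = ip a b f h + ip a b g h.
Proof.
move=> hf hg hh; rewrite -Rintegral_add; [|exact: memL2_integ_mul..].
by apply: Rintegral_ext => x _; rewrite mulrDl.
Qed.

Lemma ipDr a b f g h : memL2 a b f -> memL2 a b g -> memL2 a b h ->
  ip a b h (fun x => f x + g x) = ip a b h f + ip a b h g.
Proof. by move=> hf hg hh; rewrite !(ipC _ _ h) ipDl. Qed.

Lemma ipZl a b c f h : memL2 a b f -> memL2 a b h ->
  ip a b (fun x => c * f x) h = c * ip a b f h.
Proof.
move=> hf hh; rewrite -Rintegral_scale; last exact: memL2_integ_mul.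
by apply: Rintegral_ext => x _; rewrite mulrA.
Qed.

Lemma ipZr a b c f h : memL2 a b f -> memL2 a b h ->
  ip a b h (fun x => c * f x) = c * ip a b h f.
Proof. by move=> hf hh; rewrite !(ipC _ _ h) ipZl. Qed.

Lemma ip_ge0 a b f : 0 <= ip a b f f.
Proof. by apply: Rintegral_nneg => x _; rewrite -expr2 sqr_ge0. Qed.

(** Besides Cauchy-Schwarz this serves first-order conditions: with [A = 0], a quadratic that is
    nonnegative for all [t] has no linear term. *)
Lemma quadratic_discriminant (A B C : R) : 0 <= C ->
  (forall t, 0 <= A + 2 * t * B + t ^+ 2 * C) -> B ^+ 2 <= A * C.
Proof.
move=> C0 H; have [C00|Cn] := eqVneq C 0.
  have [->|Bn] := eqVneq B 0; first by rewrite C00 mulr0 expr0n.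
  (* When the quadratic term vanishes, this [t] brings the affine function down to [-1]. *)
  have := H (- (A + 1) / (2 * B)); rewrite C00 mulr0 addr0.
  have -> : A + 2 * (- (A + 1) / (2 * B)) * B = -1 by field.
  by rewrite lerNr oppr0 ler10.
have Cp : 0 < C by rewrite lt_neqAle eq_sym Cn.
have := H (- B / C).
have -> : A + 2 * (- B / C) * B + (- B / C) ^+ 2 * C = (A * C - B ^+ 2) / C by field.
by rewrite pmulr_lge0 ?invr_gt0// subr_ge0.
Qed.

Lemma ip_cauchy_schwarz a b f g : memL2 a b f -> memL2 a b g ->
  ip a b f g ^+ 2 <= ip a b f f * ip a b g g.
Proof.
move=> hf hg; apply: quadratic_discriminant; first exact: ip_ge0.
move=> t; have := ip_ge0 a b (fun x => f x + t * g x).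
have hz := memL2Z a b t g hg.
have hs := memL2D a b f _ hf hz.
rewrite ipDl// !ipDr// !ipZl// !ipZr// (ipC _ _ g f).
by congr (_ <= _); ring.
Qed.

Lemma wder_memL2 a b u g : weak_der a b u g -> memL2 a b u.
Proof. by case. Qed.

Lemma wder_memL2_der a b u g : weak_der a b u g -> memL2 a b g.
Proof. by case=> _ []. Qed.

Lemma wder_increment a b u g x y : weak_der a b u g -> a <= x -> x <= y -> y <= b ->
  u y - u x = Rintegral mu (Om x y) g.
Proof.
move=> [_ [hg h]] ax xy yb.
rewrite (h y) ?(le_trans ax xy)// (h x) ?ax ?(le_trans xy)//.
have ig := integ_sub a b a y g (lexx a) yb (memL2_integ _ _ _ hg).
rewrite -/(Om a y) (Rintegral_cat a y x)// -/(Om a x); ring.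
Qed.

Lemma wder_holder a b u g x y : weak_der a b u g -> a <= x -> x <= y -> y <= b ->
  (u y - u x) ^+ 2 <= (y - x) * ip a b g g.
Proof.
move=> hu ax xy yb; have hg := wder_memL2_der _ _ _ _ hu.
have hg' := memL2_sub _ _ _ _ _ ax yb hg.
rewrite (wder_increment a b u g)//.
have -> : Rintegral mu (Om x y) g = ip x y (fun=> 1) g.
  by apply: Rintegral_ext => z _; rewrite mul1r.
apply: (le_trans (ip_cauchy_schwarz _ _ _ _ (memL2_cst _ _ _) hg')).
have -> : ip x y (fun=> 1) (fun=> 1) = y - x.
  rewrite /ip (Rintegral_ext _ _ _ (fun=> 1)) ?Rintegral_const ?mul1r//.
rewrite ler_wpM2l ?subr_ge0//; apply: Rintegral_subset => //.
  exact: memL2_integ_mul.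
by move=> z _; rewrite -expr2 sqr_ge0.
Qed.

Lemma H1sq_ge0 a b u g : 0 <= H1sq a b u g.
Proof. by rewrite addr_ge0 ?ip_ge0. Qed.

Lemma wder_dist a b u g x y : weak_der a b u g -> a <= x <= b -> a <= y <= b ->
  (u y - u x) ^+ 2 <= `|y - x| * ip a b g g.
Proof.
move=> hu /andP[ax xb] /andP[ay yb]; have [xy|yx] := leP x y.
  by rewrite ger0_norm ?subr_ge0//; exact: wder_holder.
rewrite ltr0_norm ?subr_lt0// opprB -sqrrN opprB.
by apply: wder_holder => //; exact: ltW.
Qed.

(** Integrate [u x ^+ 2 <= 2 * u y ^+ 2 + 2 * (u x - u y) ^+ 2] over [y], bound the last square by
    [wder_dist], and divide by the length of the interval. *)
Lemma sobolev_sup a b : a < b -> exists2 K : R, 0 < K &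
  forall u g, weak_der a b u g -> forall x, a <= x <= b ->
    u x ^+ 2 <= K * H1sq a b u g.
Proof.
move=> ab; have ba : 0 < b - a by rewrite subr_gt0.
exists (2 / (b - a) + 2 * (b - a)).
  by rewrite addr_gt0//; [exact: divr_gt0|exact: mulr_gt0].
move=> u g hu x xab.
have hu2 := wder_memL2 _ _ _ _ hu.
have key : u x ^+ 2 * (b - a) <= 2 * ip a b u u + 2 * ((b - a) * ip a b g g) * (b - a).
  rewrite -(Rintegral_const _ _ (u x ^+ 2) (ltW ab)).
  have -> : 2 * ip a b u u + 2 * ((b - a) * ip a b g g) * (b - a) =
    Rintegral mu (Om a b) (fun y => 2 * (u y * u y) + 2 * ((b - a) * ip a b g g)).
    have iu := memL2_integ_mul _ _ _ _ hu2 hu2.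
    rewrite Rintegral_add; [|exact: integZ|exact: integ_cst].
    by rewrite Rintegral_scale// Rintegral_const// ltW.
  apply: Rintegral_mono; first exact: integ_cst.
    by apply: integD; [apply: integZ; exact: memL2_integ_mul|exact: integ_cst].
  move=> y yab; have h1 := wder_dist a b u g y x hu yab xab.
  have h2 : `|x - y| * ip a b g g <= (b - a) * ip a b g g.
    rewrite ler_wpM2r ?ip_ge0//; move: xab yab => /andP[? ?] /andP[? ?].
    by rewrite ler_norml; apply/andP; split; lra.
  have := sqr_ge0 (2 * u y - u x); nra.
have G0 := ip_ge0 a b g; have U0 := ip_ge0 a b u.
have : u x ^+ 2 <= 2 / (b - a) * ip a b u u + 2 * (b - a) * ip a b g g.
  have -> : 2 / (b - a) * ip a b u u + 2 * (b - a) * ip a b g g =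
    (2 * ip a b u u + 2 * ((b - a) * ip a b g g) * (b - a)) / (b - a).
    by field; rewrite gt_eqF.
  by rewrite ler_pdivlMr.
move=> /le_trans; apply; rewrite /H1sq.
have : 0 <= 2 / (b - a) * ip a b g g 
  by apply: mulr_ge0 => //; rewrite divr_ge0// ltW.
have : 0 <= 2 * (b - a) * ip a b u u 
  by apply: mulr_ge0 => //; rewrite mulr_ge0// ltW.
lra.
Qed.

Lemma wder_bounded a b u g : a < b -> weak_der a b u g ->
  exists2 M : R, 0 < M & forall x, a <= x <= b -> `|u x| <= M.
Proof.
move=> ab hu; have [K K0 hK] := sobolev_sup a b ab.
(* A bound free of square roots, from [|u| <= u ^+ 2 + 1]. *)
exists (K * H1sq a b u g + 1).
  by rewrite ltr_wpDl// mulr_ge0 ?H1sq_ge0 ?ltW.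
move=> x xab; have := hK u g hu x xab; rewrite -real_normK ?num_real//.
have := normr_ge0 (u x); have := sqr_ge0 (2 * `|u x| - 1); nra.
Qed.

Lemma wderD a b u g v h : weak_der a b u g -> weak_der a b v h -> a <= b ->
  weak_der a b (fun x => u x + v x) (fun x => g x + h x).
Proof.
move=> [hu [hg H1]] [hv [hh H2]] ab; split; first exact: memL2D.
split; first exact: memL2D.
move=> x /andP[ax xb]; rewrite H1 ?ax// H2 ?ax// -/(Om a x) Rintegral_add.
- by rewrite addrACA.
- by apply: integ_sub xb _ => //; exact: memL2_integ.
- by apply: integ_sub xb _ => //; exact: memL2_integ.
Qed.

Lemma wderZ a b c u g : weak_der a b u g -> weak_der a b (fun x => c * u x) (fun x => c * g x).
Proof.
move=> [hu [hg H1]]; split; first exact: memL2Z.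
split; first exact: memL2Z.
move=> x /andP[ax xb]; rewrite H1 ?ax// -/(Om a x) Rintegral_scale ?mulrDr//.
by apply: integ_sub xb _ => //; exact: memL2_integ.
Qed.

Lemma inXD bc a b u g v h : a <= b -> inX bc a b u g -> inX bc a b v h ->
  inX bc a b (fun x => u x + v x) (fun x => g x + h x).
Proof.
move=> ab [h1 b1] [h2 b2]; split; first exact: wderD.
by case: bc b1 b2 => [[-> ->] [-> ->]|-> ->]; rewrite ?addr0.
Qed.

Lemma inXZ bc a b c u g : inX bc a b u g -> inX bc a b (fun x => c * u x) (fun x => c * g x).
Proof.
move=> [h1 b1]; split; first exact: wderZ.
by case: bc b1 => [[-> ->]|->]; rewrite ?mulr0.
Qed.

Lemma inXB bc a b u g v h : a <= b -> inX bc a b u g -> inX bc a b v h ->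
  inX bc a b (fun x => u x - v x) (fun x => g x - h x).
Proof.
move=> ab h1 h2; have := inXD _ _ _ _ _ _ _ ab h1 (inXZ _ _ _ (-1) _ _ h2).
by under eq_fun do rewrite mulN1r; under [X in inX _ _ _ _ X]eq_fun do rewrite mulN1r.
Qed.

End L2Toolbox.

(** * Chain rule in [H^1] and uniqueness of the weak derivative *)

Section ChainRule.
Variable R : realType.
Notation mu := (@lebesgue_measure R).
Implicit Types (a b c x y t : R) (f df g h u v : R -> R).

Lemma continuous_bounded_on_segment f : continuous f -> forall M : R,
  exists2 B : R, 0 <= B & forall s, `|s| <= M -> `|f s| <= B.
Proof.
move=> fc M; have [M0|M0] := ltP M 0.
  by exists 0 => // s sM; have := le_lt_trans sM M0; rewrite normr_lt0.
have MM : - M <= M by lra.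
have cf : {within `[- M, M], continuous (fun x => `|f x|)}.
  apply: continuous_subspaceT => x; apply: continuous_comp; first exact: fc.
  exact: norm_continuous.
have [c cM hc] := EVT_max MM cf.
by exists `|f c| => // s sM; apply: hc; rewrite in_itv/= -ler_norml.
Qed.

Lemma le0_of_le_eps (A B : R) : 0 <= B -> (forall eta, 0 < eta -> A <= eta * B) -> A <= 0.
Proof.
move=> B0 H; rewrite leNgt; apply/negP => A0.
have B1 : 0 < 2 * (B + 1) by lra.
have := H (A / (2 * (B + 1))) (divr_gt0 A0 B1).
rewrite mulrAC ler_pdivlMr//; nra.
Qed.

(* Additivity of both sides lets a bound valid on short intervals be summed along a subdivision. *)
Lemma local_to_global_bound a b (d : R) (D G : R -> R) : 0 < d ->
  (forall x y, a <= x -> x <= y -> y <= b -> y - x <= d -> `|D y - D x| <= G y - G x) ->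
  forall x y, a <= x -> x <= y -> y <= b -> `|D y - D x| <= G y - G x.
Proof.
move=> d0 H.
have key n : forall x y, a <= x -> x <= y -> y <= b -> y - x <= d * n%:R ->
    `|D y - D x| <= G y - G x.
  elim: n => [|n IH] x y ax xy yb hn.
    by apply: H => //; rewrite (le_trans hn)// mulr0 ltW.
  have [h|h] := leP (y - x) d; first exact: H.
  have h1 : `|D (x + d) - D x| <= G (x + d) - G x by apply: H; lra.
  have h2 : `|D y - D (x + d)| <= G y - G (x + d).
    by apply: IH => //; rewrite -?natr1 in hn *; lra.
  have -> : D y - D x = (D y - D (x + d)) + (D (x + d) - D x) by ring.
  by apply: (le_trans (ler_normD _ _)); lra.
move=> x y ax xy yb; apply: (key (Num.bound ((y - x) / d))) => //.
have : (y - x) / d < (Num.bound ((y - x) / d))%:R.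
  by apply: archi_boundP; rewrite divr_ge0 ?subr_ge0// ltW.
by rewrite ltr_pdivrMr// mulrC => /ltW.
Qed.

Lemma le_norm_Rintegral a b f : integ R a b f ->
  `|Rintegral mu (Om a b) f| <= Rintegral mu (Om a b) (fun x => `|f x|).
Proof.
by move=> hf; apply: le_normr_Rintegral => //; exact: measurable_Om.
Qed.

Lemma Rintegral_point a f : integ R a a f -> Rintegral mu (Om a a) f = 0.
Proof.
by move=> hf; have := Rintegral_cat R a a a f hf (lexx a) (lexx a); lra.
Qed.

Lemma continuous_comp_measurable a b f u : continuous f ->
  measurable_fun (Om a b) u -> measurable_fun (Om a b) (fun x => f (u x)).
Proof.
move=> fc mu'; apply: (measurableT_comp (f := f)) => //.
exact: continuous_measurable_fun.
Qed.

Lemma wder_unif_continuous a b u g (d : R) : 0 < d -> weak_der a b u g ->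
  exists2 r : R, 0 < r & forall x y, a <= x <= b -> a <= y <= b -> `|y - x| <= r ->
    `|u y - u x| <= d.
Proof.
move=> d0 hu; have G0 := ip_ge0 R a b g; set E := ip a b g g in G0.
have E1 : 0 < E + 1 by lra.
exists (d ^+ 2 / (E + 1)); first by rewrite divr_gt0// exprn_gt0.
move=> x y xab yab; rewrite ler_pdivlMr// => h.
have := wder_dist R a b u g x y hu xab yab; rewrite -/E => H.
rewrite -(ler_pXn2r (n := 2))// ?nnegrE ?(ltW d0)// real_normK ?num_real//.
apply: (le_trans H); apply: le_trans h.
by rewrite ler_wpM2l//; lra.
Qed.

(** The proof avoids pointwise derivatives of [u]. The defect between [f (u x)] and the integral of
    [df (u) * g] has increments bounded, on short intervals, by [eta] times the integral of [|g|];
    summing over a subdivision and letting [eta] tend to 0 shows that the defect is constant. *)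
Lemma wder_comp a b f df u g : a < b -> (forall x, is_derive x (1:R) f (df x)) ->
  continuous df -> weak_der a b u g ->
  weak_der a b (fun x => f (u x)) (fun x => df (u x) * g x).
Proof.
move=> ab fd dfc hu.
have fc : continuous f.
  by move=> x; apply: differentiable_continuous; apply/derivable1_diffP; case: (fd x).
have [M M0 uM] := wder_bounded R a b u g ab hu.
have u2 := wder_memL2 R _ _ _ _ hu; have g2 := wder_memL2_der R _ _ _ _ hu.
have mu' : measurable_fun (Om a b) u by case: u2.
have [B B0 fB] := continuous_bounded_on_segment f fc M.
have [B' B'0 dfB] := continuous_bounded_on_segment df dfc M.
have fu2 : memL2 a b (fun x => f (u x)).
  apply: (memL2_bounded R a b B); first exact: continuous_comp_measurable.
  by move=> x xab; apply/fB/uM.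
have dfg2 : memL2 a b (fun x => df (u x) * g x).
  apply: (memL2_bounded_mul R a b B') => //; first exact: continuous_comp_measurable.
  by move=> x xab; apply/dfB/uM.
split=> //; split=> // x0 /andP[ax0 x0b].
have ag2 := memL2_abs R _ _ _ g2.
have iag := memL2_integ R _ _ _ ag2.
have ig := memL2_integ R _ _ _ g2.
have idfg := memL2_integ R _ _ _ dfg2.
pose I h x := Rintegral mu (Om a x) h.
have Icat h x y : integ R a b h -> a <= x -> x <= y -> y <= b ->
    I h y - I h x = Rintegral mu (Om x y) h.
  move=> ih ax xy yb; rewrite /I (Rintegral_cat R a y x h)//; last first.
    exact: integ_sub ih.
  by rewrite addrC addKr.
have I0 h : integ R a b h -> I h a = 0.
  by move=> ih; apply: Rintegral_point; apply: integ_sub ih => //; exact: ltW.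
pose D x := f (u x) - I (fun x => df (u x) * g x) x.
have key eta : 0 < eta -> `|D x0 - D a| <= eta * I (fun x => `|g x|) x0.
  move=> eta0.
  have eta2 : 0 < eta / 2 by lra.
  have [d1 d10 hd1] := unif_first_order R f df fd dfc M _ eta2.
  have [d2 d20 hd2] := continuous_unif_on_segment R df dfc M _ eta2.
  have d0 : 0 < Num.min d1 d2 by rewrite lt_min d10 d20.
  have [r r0 hr] := wder_unif_continuous a b u g _ d0 hu.
  have := local_to_global_bound a b r D (fun x => eta * I (fun x => `|g x|) x) r0.
  move=> /(_ _ a x0 (lexx a) ax0 x0b); rewrite I0// mulr0 subr0; apply.
  move=> x y ax xy yb yxr.
  have xab : a <= x <= b by rewrite ax (le_trans xy).
  have close z : x <= z <= y -> `|u z - u x| <= d1 /\ `|u z - u x| <= d2.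
    move=> /andP[xz zy].
    have : `|u z - u x| <= Num.min d1 d2.
      apply: hr => //; first by rewrite (le_trans ax xz) (le_trans zy yb).
      by rewrite ger0_norm ?subr_ge0//; lra.
    by rewrite le_min => /andP.
  have ig' := integ_sub R _ _ _ _ _ ax yb ig.
  have iag' := integ_sub R _ _ _ _ _ ax yb iag.
  have idfg' := integ_sub R _ _ _ _ _ ax yb idfg.
  (* Both increments are compared with [df] frozen at the left end [u x]; each comparison costs
     [eta / 2]. *)
  have -> : D y - D x = (f (u y) - f (u x) - df (u x) * (u y - u x))
      + Rintegral mu (Om x y) (fun z => df (u x) * g z + (-1) * (df (u z) * g z)).
    rewrite Rintegral_add//; [|exact: integZ..].
    rewrite !Rintegral_scale// -(wder_increment R a b u g)//.
    by rewrite -(Icat (fun z => df (u z) * g z))// /D; ring.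
  rewrite -mulrBr Icat//.
  have h1 : `|f (u y) - f (u x) - df (u x) * (u y - u x)|
      <= eta / 2 * Rintegral mu (Om x y) (fun x => `|g x|).
    have [hy _] : `|u y - u x| <= d1 /\ `|u y - u x| <= d2.
      by apply: close; rewrite xy lexx.
    have := hd1 (u x) (u y - u x) (uM _ xab) hy.
    rewrite [u x + _]addrC subrK => /le_trans; apply.
    apply: ler_wpM2l; first exact: ltW.
    by rewrite (wder_increment R a b u g)//; exact: le_norm_Rintegral.
  have h2 : `|Rintegral mu (Om x y) (fun z => df (u x) * g z + (-1) * (df (u z) * g z))|
      <= eta / 2 * Rintegral mu (Om x y) (fun x => `|g x|).
    have ii : integ R x y (fun z => df (u x) * g z + (-1) * (df (u z) * g z)).
      by apply: integD; exact: integZ.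
    have pw z : x <= z <= y ->
        `|df (u x) * g z + (-1) * (df (u z) * g z)| <= eta / 2 * `|g z|.
      move=> xzy; have [_ hz] := close z xzy.
      have := hd2 (u x) (u z - u x) (uM _ xab) hz.
      rewrite [u x + _]addrC subrK => hh.
      have -> : df (u x) * g z + (-1) * (df (u z) * g z) =
        - ((df (u z) - df (u x)) * g z) by ring.
      by rewrite normrN normrM ler_wpM2r.
    have iabs : integ R x y (fun z => `|df (u x) * g z + (-1) * (df (u z) * g z)|).
      apply: (integ_dominated R _ _ _ (fun z => eta / 2 * `|g z|)).
      - apply: measurableT_comp; first exact: normr_measurable.
        exact: integ_measurable ii.
      - exact: integZ.
      - by move=> z /pw; rewrite normr_id.
    apply: (le_trans (le_norm_Rintegral _ _ _ ii)).
    rewrite -Rintegral_scale//; apply: Rintegral_mono => //.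
    exact: integZ.
  by apply: (le_trans (ler_normD _ _)); lra.
have IG0 : 0 <= I (fun x => `|g x|) x0 by apply: Rintegral_nneg.
have := le0_of_le_eps _ _ IG0 key; rewrite normr_le0 subr_eq0 /D I0// subr0.
by move=> /eqP <-; rewrite /I subrK.
Qed.

(** Makes [nl p (u)] an admissible test function, with the very derivative that [lam] uses. The
    Dirichlet condition survives because [nl p 0 = 0]. *)
Lemma inX_nl bc a b (p : R) u g : a < b -> 1 < p -> inX bc a b u g ->
  inX bc a b (fun x => nl p (u x)) (fun x => p * `|u x| `^ (p - 1) * g x).
Proof.
move=> ab hp [hu hb]; split.
  apply: (wder_comp a b (nl p) (fun s => p * `|s| `^ (p - 1))) => //.
    by move=> x; exact: is_derive_nl.
  exact: dnl_continuous.
by case: bc hb => [[-> ->]|->//]; rewrite /nl mulr0.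
Qed.

(** By Lebesgue differentiation the primitive has derivative [h] almost everywhere; being constantly
    0, it forces [h = 0] almost everywhere. Hence the derivative component of an [inX] pair is
    unique up to null sets. *)
Lemma ip_eq0_of_null_primitive a b h : a < b -> memL2 a b h ->
  (forall x, a <= x <= b -> Rintegral mu (Om a x) h = 0) -> ip a b h h = 0.
Proof.
move=> ab h2 H; have ih := memL2_integ R _ _ _ h2.
(* Extension by zero, so that the differentiation theorem applies on the whole line. *)
pose f := h \_ (Om a b).
have mO : measurable (Om a b) by exact: measurable_Om.
have fT : mu.-integrable setT (EFin \o f).
  by move: ih; rewrite /integ integrable_mkcond// restrict_EFin.
have lf : locally_integrable setT f by apply: integrable_locally.
have iy y : mu.-integrable [set` Interval (BLeft a) (BRight y)] (EFin \o f).
  by apply: (integrableS _ _ _ fT) => //; exact: measurable_itv.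
have := @FTC1 R f (BLeft a) iy lf.
move=> ae0.
have ae1 : {ae mu, forall x, x \in `]a, b[ -> h x = 0}.
  move: ae0; apply: filterS; first exact: (ae_filter_ringOfSetsType mu).
  move=> x + /[dup] xab; rewrite in_itv/= => + /andP[ax xb].
  rewrite lte_fin ax => /(_ isT)[_].
  rewrite (_ : f x = h x); last first.
    by rewrite /f patchE mem_set// /Om/= in_itv/= !ltW.
  move=> <-.
  rewrite derive1E (@near_eq_derive _ _ _ _ (cst 0)) ?derive_cst//.
  near=> y.
  have yab : a < y < b.
    by near: y; apply: near_in_itvoo; rewrite in_itv/= ax.
  move: yab => /andP[ay yb].
  rewrite /cst -[RHS](H y) ?ltW//.
  apply: eq_Rintegral => z; rewrite inE/= in_itv/= => /andP[az zy].
  by rewrite /f patchE mem_set// /Om/= in_itv/= az (le_trans zy)// ltW.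
have hh := memL2_integ_mul R _ _ _ _ h2 h2.
(* The almost everywhere statement concerns interior points, so the two endpoints are dropped as
   null sets. *)
rewrite /ip /Om -Rintegral_itv_obnd_cbnd; last first.
  apply: (integrableS _ _ _ hh) => //.
  by move=> z; rewrite /Om/= !in_itv/= => /andP[/ltW -> ->].
rewrite -Rintegral_itv_bndo_bndc; last first.
  apply: (integrableS _ _ _ hh) => //.
  by move=> z; rewrite /Om/= !in_itv/= => /andP[/ltW -> /ltW ->].
rewrite /Rintegral (ae_eq_integral (cst 0%E)) ?integral0//.
- have mh := integ_measurable R _ _ _ hh.
  apply/measurable_EFinP; apply: measurable_funS mh => //.
  by move=> z; rewrite /Om/= !in_itv/= => /andP[/ltW -> /ltW ->].
- move: ae1; apply: filterS; first exact: (ae_filter_ringOfSetsType mu).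
  by move=> x Hx xab; rewrite Hx ?mul0r.
Unshelve. all: by end_near. Qed.

End ChainRule.

(** * The energy form, its sign, and the Euler-Lagrange equation *)

Section Energy.
Variable R : realType.
Notation mu := (@lebesgue_measure R).
Implicit Types (a b c x y t p om : R) (V u v w h : R -> R).

Definition bounded_potential a b V :=
  measurable_fun (Om a b) V /\ exists M : R, forall x, a <= x <= b -> 0 <= V x <= M.

Lemma memL2_potential a b V u : bounded_potential a b V -> memL2 a b u ->
  memL2 a b (fun x => V x * u x).
Proof.
move=> [mV [M VM]] hu; apply: (memL2_bounded_mul R a b M) => // x xab.
by have /andP[V0 VM'] := VM x xab; rewrite ger0_norm.
Qed.

Lemma AformC a b V om u u' v v' : Aform a b V om u u' v v' = Aform a b V om v v' u u'.
Proof.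
rewrite /Aform (ipC R _ _ u' v') (ipC R _ _ u v); congr (_ + _ + _).
by apply: Rintegral_ext => x _; ring.
Qed.

Lemma AformDl a b V om u u' v v' w w' : bounded_potential a b V ->
  weak_der a b u u' -> weak_der a b v v' -> weak_der a b w w' ->
  Aform a b V om (fun x => u x + v x) (fun x => u' x + v' x) w w' =
  Aform a b V om u u' w w' + Aform a b V om v v' w w'.
Proof.
move=> hV [u2 [u2' _]] [v2 [v2' _]] [w2 [w2' _]]; rewrite /Aform !ipDl//.
have -> : ip a b (fun x => V x * (u x + v x)) w =
   ip a b (fun x => V x * u x + V x * v x) w.
  by apply: ip_ext => // x _; rewrite mulrDr.
by rewrite ipDl//; [ring|exact: memL2_potential..].
Qed.

Lemma AformZl a b V om c u u' w w' : bounded_potential a b V ->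
  weak_der a b u u' -> weak_der a b w w' ->
  Aform a b V om (fun x => c * u x) (fun x => c * u' x) w w' =
  c * Aform a b V om u u' w w'.
Proof.
move=> hV [u2 [u2' _]] [w2 [w2' _]]; rewrite /Aform !ipZl//.
have -> : ip a b (fun x => V x * (c * u x)) w = ip a b (fun x => c * (V x * u x)) w.
  by apply: ip_ext => // x _; ring.
by rewrite ipZl//; [ring|exact: memL2_potential].
Qed.

Lemma AformDr a b V om u u' v v' w w' : bounded_potential a b V ->
  weak_der a b u u' -> weak_der a b v v' -> weak_der a b w w' ->
  Aform a b V om w w' (fun x => u x + v x) (fun x => u' x + v' x) =
  Aform a b V om w w' u u' + Aform a b V om w w' v v'.
Proof. by move=> *; rewrite !(AformC _ _ _ _ w) AformDl. Qed.

Lemma AformZr a b V om c u u' w w' : bounded_potential a b V ->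
  weak_der a b u u' -> weak_der a b w w' ->
  Aform a b V om w w' (fun x => c * u x) (fun x => c * u' x) =
  c * Aform a b V om w w' u u'.
Proof. by move=> *; rewrite !(AformC _ _ _ _ w) AformZl. Qed.

Lemma Qf_Aform a b V om u u' : Qf a b V om u u' = Aform a b V om u u' u u'.
Proof. by []. Qed.

Lemma QfD a b V om u u' v v' : bounded_potential a b V -> a <= b ->
  weak_der a b u u' -> weak_der a b v v' ->
  Qf a b V om (fun x => u x + v x) (fun x => u' x + v' x) =
  Qf a b V om u u' + 2 * Aform a b V om u u' v v' + Qf a b V om v v'.
Proof.
move=> hV ab hu hv; rewrite !Qf_Aform.
have huv := wderD R a b _ _ _ _ hu hv ab.
rewrite AformDl// !AformDr// (AformC _ _ _ _ v v' u u'); ring.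
Qed.

Lemma QfZ a b V om c u u' : bounded_potential a b V -> weak_der a b u u' ->
  Qf a b V om (fun x => c * u x) (fun x => c * u' x) = c ^+ 2 * Qf a b V om u u'.
Proof.
move=> hV hu; rewrite !Qf_Aform.
have hcu := wderZ R a b c _ _ hu.
by rewrite AformZl// AformZr// mulrA expr2.
Qed.

Lemma Qf_le a b V om : bounded_potential a b V -> exists2 K : R, 0 < K &
  forall u u', weak_der a b u u' -> `|Qf a b V om u u'| <= K * H1sq a b u u'.
Proof.
move=> hV; have [mV [M VM]] := hV.
exists (2^-1 + `|M| + `|om|).
  by rewrite -addrA ltr_wpDr ?invr_gt0// addr_ge0.
move=> u u' hu; have [u2 [u2' _]] := hu.
have U0 := ip_ge0 R a b u; have U0' := ip_ge0 R a b u'.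
have V0 : 0 <= ip a b (fun x => V x * u x) u.
  apply: Rintegral_nneg => x /VM /andP[V0 _].
  by rewrite -mulrA mulr_ge0// -expr2 sqr_ge0.
have V1 : ip a b (fun x => V x * u x) u <= `|M| * ip a b u u.
  rewrite -ipZl//; apply: Rintegral_mono.
  - by apply: memL2_integ_mul => //; exact: memL2_potential.
  - by apply: memL2_integ_mul => //; exact: memL2Z.
  - move=> x /VM /andP[_ VM']; rewrite -2!mulrA ler_wpM2r//.
      by rewrite -expr2 sqr_ge0.
    by rewrite (le_trans VM')// ler_norm.
rewrite /Qf /Q0 /H1sq.
have o1 := ler_norm om; have o2 := ler_norm (- om); rewrite normrN in o2.
have M0 := normr_ge0 M; have O0 := normr_ge0 om.
have h2 : (2^-1 : R) = 1 / 2 by rewrite div1r.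
rewrite ler_norml h2; apply/andP; split; nra.
Qed.

Lemma Aform_bounded a b V om u u' : bounded_potential a b V -> weak_der a b u u' ->
  exists2 K : R, 0 <= K &
  forall v v', weak_der a b v v' -> Aform a b V om u u' v v' ^+ 2 <= K * H1sq a b v v'.
Proof.
move=> hV hu; have [u2 [u2' _]] := hu.
have Vu2 := memL2_potential a b V u hV u2.
pose K1 := ip a b u' u'; pose K2 := ip a b (fun x => V x * u x) (fun x => V x * u x).
pose K3 := ip a b u u.
have K10 : 0 <= K1 by exact: ip_ge0.
have K20 : 0 <= K2 by exact: ip_ge0.
have K30 : 0 <= K3 by exact: ip_ge0.
exists (3 * (K1 + K2 + om ^+ 2 * K3)).
  by rewrite mulr_ge0// !addr_ge0// mulr_ge0// sqr_ge0.
move=> v v' hv; have [v2 [v2' _]] := hv.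
have c1 := ip_cauchy_schwarz R a b _ _ u2' v2'; rewrite -/K1 in c1.
have c2 := ip_cauchy_schwarz R a b _ _ Vu2 v2; rewrite -/K2 in c2.
have c3 := ip_cauchy_schwarz R a b _ _ u2 v2; rewrite -/K3 in c3.
have V0 := ip_ge0 R a b v; have V0' := ip_ge0 R a b v'.
rewrite /Aform /H1sq.
set A1 := ip a b u' v' in c1 *; set A2 := ip a b (fun x => V x * u x) v in c2 *.
set A3 := ip a b u v in c3 *; set n := ip a b v v in c2 c3 V0 *.
set n' := ip a b v' v' in c1 V0' *.
have c3' : om ^+ 2 * A3 ^+ 2 <= om ^+ 2 * (K3 * n) by rewrite ler_wpM2l ?sqr_ge0.
have s3 : (2^-1 * A1 + A2 + om * A3) ^+ 2 <= 3 * (A1 ^+ 2 + A2 ^+ 2 + om ^+ 2 * A3 ^+ 2).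
  have -> : (2^-1 : R) = 1 / 2 by rewrite div1r.
  have q1 := sqr_ge0 (1 / 2 * A1 - A2); have q2 := sqr_ge0 (1 / 2 * A1 - om * A3).
  have q3 := sqr_ge0 (A2 - om * A3); have q4 := sqr_ge0 A1; nra.
have p1 : 0 <= K1 * n by rewrite mulr_ge0.
have p2 : 0 <= K2 * n' by rewrite mulr_ge0.
have p3 : 0 <= om ^+ 2 * K3 * n'.
  by apply: mulr_ge0 => //; apply: mulr_ge0 => //; exact: sqr_ge0.
apply: (le_trans s3); lra.
Qed.

(** Normalizing [u] in [L^2] compares it with the infimum [lambda0], and (A2) makes [lambda0 + om]
    positive. This gives the sign of [Q]; the lower bound in [H^1] comes later, from (ND). *)
Lemma Qf_ge0 bc a b V om u u' : a < b -> bounded_potential a b V ->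
  - lambda0 bc a b V < om -> inX bc a b u u' -> 0 <= Qf a b V om u u'.
Proof.
move=> ab hV hom hu; have [mV [M VM]] := hV.
have Q00 v v' : 0 <= Q0 a b V v v'.
  rewrite addr_ge0 ?mulr_ge0 ?ip_ge0 ?invr_ge0//.
  apply: Rintegral_nneg => x /VM /andP[V0 _].
  by rewrite -mulrA mulr_ge0// -expr2 sqr_ge0.
have [u0|un0] := eqVneq (ip a b u u) 0.
  by rewrite /Qf u0 mulr0 addr0.
have up : 0 < ip a b u u by rewrite lt_neqAle eq_sym un0 ip_ge0.
pose r := Num.sqrt (ip a b u u).
have r0 : 0 < r by rewrite sqrtr_gt0.
have rr : r ^+ 2 = ip a b u u by rewrite sqr_sqrtr// ltW.
have [wu _] := hu; have [u2 [u2' _]] := wu.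
pose v := fun x => r^-1 * u x; pose v' := fun x => r^-1 * u' x.
have hv : inX bc a b v v' by exact: inXZ.
have hv1 : ip a b v v = 1.
  rewrite ipZl// ?ipZr//; last exact: memL2Z.
  by rewrite -rr; field; rewrite gt_eqF.
(* [ge_inf] asks for a lower bound of the set; 0 is one because [V >= 0]. *)
have lb : lambda0 bc a b V <= Q0 a b V v v'.
  apply: ge_inf; last by exists v, v'.
  by exists 0 => _ [z [z' [_ [_ ->]]]].
have Qv : 0 <= Qf a b V om v v'.
  by rewrite /Qf hv1 mulr1; lra.
rewrite /v /v' QfZ// in Qv.
by rewrite pmulr_rge0 ?exprn_gt0 ?invr_gt0 in Qv.
Qed.

Lemma memL2_comp a b (f : R -> R) u u' : a < b -> continuous f -> weak_der a b u u' ->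
  memL2 a b (fun x => f (u x)).
Proof.
move=> ab fc hu; have [M M0 uM] := wder_bounded R a b u u' ab hu.
have [B B0 fB] := continuous_bounded_on_segment R f fc M.
apply: (memL2_bounded R a b B).
  by apply: continuous_comp_measurable => //; case: hu => -[].
by move=> x /uM /fB.
Qed.

Lemma memL2_nl a b p u u' : a < b -> 1 < p -> weak_der a b u u' ->
  memL2 a b (fun x => nl p (u x)).
Proof. by move=> ab hp; apply: memL2_comp => //; exact: nl_continuous. Qed.

Lemma memL2_weight a b p u u' h : a < b -> 1 < p -> weak_der a b u u' -> memL2 a b h ->
  memL2 a b (fun x => `|u x| `^ (p - 1) * h x).
Proof.
move=> ab hp hu hh; have [M M0 uM] := wder_bounded R a b u u' ab hu.
have fc : continuous (fun s : R => `|s| `^ (p - 1)).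
  by apply: absr_powR_continuous; rewrite subr_gt0.
have [B B0 fB] := continuous_bounded_on_segment R _ fc M.
apply: (memL2_bounded_mul R a b B) => //.
  by apply: (continuous_comp_measurable R a b _ u fc); case: hu => -[].
by move=> x /uM /fB.
Qed.

Lemma integ_pow a b p u u' : a < b -> 1 < p -> weak_der a b u u' ->
  integ R a b (fun x => `|u x| `^ (p + 1)).
Proof.
move=> ab hp hu; apply: memL2_integ.
apply: (memL2_comp a b (fun s : R => `|s| `^ (p + 1)) u u') => //.
by apply: absr_powR_continuous; lra.
Qed.

Lemma ip_nl_self a b p u : 1 < p -> ip a b (fun x => nl p (u x)) u = intpow a b (p + 1) u.
Proof. by move=> hp; apply: Rintegral_ext => x _; rewrite absr_powRM. Qed.

(** Geometrically, the [L^(p+1)] ball lies on one side of its tangent hyperplanes. This fixes the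
    sign of [<nl ug, xi>] on the sphere and shows that tangent steps do not enter the open ball. *)
Lemma intpow_convex a b p u u' h h' : a < b -> 1 < p ->
  weak_der a b u u' -> weak_der a b h h' ->
  intpow a b (p + 1) u + (p + 1) * ip a b (fun x => nl p (u x)) h
    <= intpow a b (p + 1) (fun x => u x + h x).
Proof.
move=> ab hp hu hh; have un := memL2_nl a b p u u' ab hp hu.
have h2 := wder_memL2 R _ _ _ _ hh.
have iu := integ_pow a b p u u' ab hp hu.
have inh := memL2_integ_mul R _ _ _ _ un h2.
rewrite /ip /intpow -Rintegral_scale// -Rintegral_add//; last exact: integZ.
apply: Rintegral_mono.
- by apply: integD => //; exact: integZ.
- by apply: integ_pow => //; apply: wderD hu hh _; exact: ltW.
- by move=> x _; rewrite mulrA; exact: absr_powR_convex.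
Qed.

(** The pointwise remainder [T] stays abstract because it is used twice: with the sharp second-order
    error and with the crude quadratic one. *)
Lemma intpow_upper a b p u u' h h' (T : R -> R) : a < b -> 1 < p ->
  weak_der a b u u' -> weak_der a b h h' -> integ R a b T ->
  (forall x, a <= x <= b ->
    `|u x + h x| `^ (p + 1) - `|u x| `^ (p + 1) - (p + 1) * nl p (u x) * h x <= T x) ->
  intpow a b (p + 1) (fun x => u x + h x) <=
    intpow a b (p + 1) u + (p + 1) * ip a b (fun x => nl p (u x)) h + Rintegral mu (Om a b) T.
Proof.
move=> ab hp hu hh iT hT; have un := memL2_nl a b p u u' ab hp hu.
have h2 := wder_memL2 R _ _ _ _ hh.
have iu := integ_pow a b p u u' ab hp hu.
have inh := memL2_integ_mul R _ _ _ _ un h2.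
have inZ : integ R a b (fun x => (p + 1) * (nl p (u x) * h x)) by exact: integZ.
rewrite /ip /intpow -Rintegral_scale// -!Rintegral_add//; last exact: integD.
apply: Rintegral_mono.
- by apply: integ_pow => //; apply: wderD hu hh _; exact: ltW.
- by apply: integD => //; apply: integD.
- by move=> x /hT; lra.
Qed.

Lemma intpow_scale a b p c u u' : a < b -> 1 < p -> 0 <= c -> weak_der a b u u' ->
  intpow a b (p + 1) (fun x => c * u x) = c `^ (p + 1) * intpow a b (p + 1) u.
Proof.
move=> ab hp c0 hu; have iu := integ_pow a b p u u' ab hp hu.
rewrite /intpow -Rintegral_scale//; apply: Rintegral_ext => x _.
by rewrite normrM (ger0_norm c0) powRM.
Qed.

Definition is_ground_state bc a b V p om (ug ug' : R -> R) :=
  [/\ inX bc a b ug ug', onS a b p ug & forall u u', inX bc a b u u' -> onS a b p u ->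
     Qf a b V om ug ug' <= Qf a b V om u u'].

(* Scaling down onto the sphere can only decrease Q, since Q >= 0. *)
Lemma ground_state_min_outside bc a b V p om ug ug' v v' : a < b -> 1 < p ->
  bounded_potential a b V -> - lambda0 bc a b V < om ->
  is_ground_state bc a b V p om ug ug' ->
  inX bc a b v v' -> 1 <= intpow a b (p + 1) v -> Qf a b V om ug ug' <= Qf a b V om v v'.
Proof.
move=> ab hp hV hom [_ _ hmin] hv N1; set N := intpow a b (p + 1) v in N1 *.
have wv : weak_der a b v v' by case: hv.
have N0 : 0 <= N by lra.
have p1 : p + 1 != 0 by rewrite gt_eqF//; lra.
pose c := (N `^ (p + 1)^-1)^-1.
have Nr1 : 1 <= N `^ (p + 1)^-1.
  have : (1 : R) `^ (p + 1)^-1 <= N `^ (p + 1)^-1.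
    by apply: ge0_ler_powR => //; rewrite ?nnegrE ?invr_ge0//; lra.
  by rewrite powR1.
have c0 : 0 <= c by rewrite invr_ge0; lra.
have c1 : c <= 1 by rewrite invf_le1//; lra.
have hS : onS a b p (fun x => c * v x).
  rewrite /onS (intpow_scale _ _ _ _ _ v')// -/N.
  have -> : c = N `^ (- (p + 1)^-1) by rewrite powRN.
  rewrite -powRrM mulNr mulVf// powRN powRr1// mulVf// gt_eqF//; lra.
have := hmin _ _ (inXZ R bc a b c v v' hv) hS.
rewrite QfZ// => /le_trans; apply.
rewrite ler_piMl//; first exact: (Qf_ge0 bc).
by rewrite expr_le1.
Qed.

(** Straight lines replace curves on the sphere: for a tangent [psi], [Q(ug + t psi) - Q(ug)] is a
    quadratic in [t] that stays nonnegative, so its linear term vanishes. *)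
Lemma euler_lagrange bc a b V p om ug ug' phi phi' : a < b -> 1 < p ->
  bounded_potential a b V -> - lambda0 bc a b V < om ->
  is_ground_state bc a b V p om ug ug' -> inX bc a b phi phi' ->
  Aform a b V om ug ug' phi phi' = Qf a b V om ug ug' * ip a b (fun x => nl p (ug x)) phi.
Proof.
move=> ab hp hV hom hg hphi; have [gX gS _] := hg.
have [wg _] := gX; have g2 := wder_memL2 R _ _ _ _ wg.
have ng := memL2_nl a b p ug ug' ab hp wg.
have tangent psi psi' : inX bc a b psi psi' -> ip a b (fun x => nl p (ug x)) psi = 0 ->
    Aform a b V om ug ug' psi psi' = 0.
  move=> hpsi psi0; have [wpsi _] := hpsi; have psi2 := wder_memL2 R _ _ _ _ wpsi.
  have := quadratic_discriminant R 0 (Aform a b V om ug ug' psi psi')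
    (Qf a b V om psi psi') (Qf_ge0 bc a b V om _ _ ab hV hom hpsi).
  rewrite mul0r => H; apply/eqP; rewrite -sqrf_eq0 eq_le sqr_ge0 andbT; apply: H => t.
  have htp := inXZ R bc a b t _ _ hpsi; have [wtp _] := htp.
  have hv := inXD R bc a b _ _ _ _ (ltW ab) gX htp.
  (* By convexity, moving along a tangent direction leaves the unit ball. *)
  have N1 : 1 <= intpow a b (p + 1) (fun x => ug x + t * psi x).
    have := intpow_convex a b p ug ug' _ _ ab hp wg wtp.
    by rewrite gS ipZr// psi0 !mulr0 addr0.
  have := ground_state_min_outside bc a b V p om ug ug' _ _ ab hp hV hom hg hv N1.
  have ab' := ltW ab; rewrite QfD// AformZr// QfZ//; lra.
(* For general [phi], the function [phi - <nl ug, phi> ug] is tangent because [<nl ug, ug> = 1]. *)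
have hk := inXZ R bc a b (- ip a b (fun x => nl p (ug x)) phi) _ _ gX.
have hT := inXD R bc a b _ _ _ _ (ltW ab) hphi hk.
have [wphi _] := hphi; have phi2 := wder_memL2 R _ _ _ _ wphi.
have [wk _] := hk.
have := tangent _ _ hT.
rewrite ipDr//; last exact: memL2Z.
rewrite ipZr// ip_nl_self// gS mulr1 subrr => /(_ erefl).
rewrite AformDr// AformZr// -Qf_Aform; lra.
Qed.

End Energy.

(** * Energy gap and slope near the ground state *)

Section LocalEstimates.
Variable R : realType.
Notation mu := (@lebesgue_measure R).
Implicit Types (a b c x y t p om : R) (V u v w h xi : R -> R).

Lemma ipD_le a b u v : memL2 a b u -> memL2 a b v ->
  ip a b (fun x => u x + v x) (fun x => u x + v x) <= 2 * ip a b u u + 2 * ip a b v v.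
Proof.
move=> hu hv; have uu := memL2_integ_mul R _ _ _ _ hu hu.
have vv := memL2_integ_mul R _ _ _ _ hv hv.
rewrite /ip -!Rintegral_scale// -Rintegral_add; [|exact: integZ..].
apply: Rintegral_mono.
- by apply: memL2_integ_mul; exact: memL2D.
- by apply: integD; exact: integZ.
- by move=> x _; have := sqr_ge0 (u x - v x); nra.
Qed.

Lemma H1sqD_le a b u u' v v' : weak_der a b u u' -> weak_der a b v v' ->
  H1sq a b (fun x => u x + v x) (fun x => u' x + v' x) <=
  2 * H1sq a b u u' + 2 * H1sq a b v v'.
Proof.
move=> [u2 [u2' _]] [v2 [v2' _]]; have := ipD_le a b u v u2 v2.
by have := ipD_le a b u' v' u2' v2'; rewrite /H1sq; lra.
Qed.

Lemma ip_scale_sq a b c u : memL2 a b u ->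
  ip a b (fun x => c * u x) (fun x => c * u x) = c ^+ 2 * ip a b u u.
Proof. by move=> u2; have cu2 := memL2Z R a b c _ u2; rewrite ipZl// ipZr// mulrA. Qed.

Lemma H1sqZ a b c u u' : weak_der a b u u' ->
  H1sq a b (fun x => c * u x) (fun x => c * u' x) = c ^+ 2 * H1sq a b u u'.
Proof. by move=> [u2 [u2' _]]; rewrite /H1sq !ip_scale_sq// mulrDr. Qed.

(** This linearization is what makes the second variation reappear in the slope estimate. *)
Lemma nl_first_order a b p u u' xi xi' (eta : R) : a < b -> 1 < p ->
  weak_der a b u u' -> weak_der a b xi xi' ->
  (forall x, a <= x <= b ->
    `|nl p (u x + xi x) - nl p (u x) - p * `|u x| `^ (p - 1) * xi x| <= eta * `|xi x|) ->
  `|ip a b (fun x => nl p (u x + xi x)) xi - ip a b (fun x => nl p (u x)) xi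
    - p * ip a b (fun x => `|u x| `^ (p - 1) * xi x) xi| <= eta * ip a b xi xi.
Proof.
move=> ab hp hu hxi H; have hv := wderD R a b _ _ _ _ hu hxi (ltW ab).
have x2 := wder_memL2 R _ _ _ _ hxi.
have un := memL2_nl R a b p u u' ab hp hu.
have vn := memL2_nl R a b p _ _ ab hp hv.
have wx := memL2_weight R a b p u u' xi ab hp hu x2.
have i1 := memL2_integ_mul R _ _ _ _ vn x2.
have i2 := memL2_integ_mul R _ _ _ _ un x2.
have i3 := memL2_integ_mul R _ _ _ _ wx x2.
have i4 := memL2_integ_mul R _ _ _ _ x2 x2.
pose F x := nl p (u x + xi x) * xi x
  + (-1 * (nl p (u x) * xi x) + - p * (`|u x| `^ (p - 1) * xi x * xi x)).
have iF : integ R a b F by apply: integD => //; apply: integD; exact: integZ.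
have -> : ip a b (fun x => nl p (u x + xi x)) xi - ip a b (fun x => nl p (u x)) xi
    - p * ip a b (fun x => `|u x| `^ (p - 1) * xi x) xi = Rintegral mu (Om a b) F.
  rewrite Rintegral_add//; last by apply: integD; exact: integZ.
  rewrite Rintegral_add; [|exact: integZ..].
  by rewrite !Rintegral_scale// /ip; ring.
have pw x : a <= x <= b -> `|F x| <= eta * (xi x * xi x).
  move=> /H Hx.
  have -> : F x = (nl p (u x + xi x) - nl p (u x) - p * `|u x| `^ (p - 1) * xi x) * xi x.
    by rewrite /F; ring.
  rewrite normrM -expr2 -(real_normK (num_real (xi x))) expr2 mulrA.
  exact: ler_wpM2r.
have iaF : integ R a b (fun x => `|F x|).
  apply: (integ_dominated R _ _ _ (fun x => eta * (xi x * xi x))).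
  - apply: measurableT_comp; first exact: normr_measurable.
    exact: integ_measurable iF.
  - exact: integZ.
  - by move=> x /pw; rewrite normr_id.
apply: (le_trans (le_norm_Rintegral R _ _ _ iF)).
rewrite /ip -Rintegral_scale//; apply: Rintegral_mono => //; exact: integZ.
Qed.

Lemma exists_small (A B : R) : 0 <= A -> 0 < B ->
  exists2 d : R, 0 < d & forall m, 0 <= m -> m <= d -> A * m <= B.
Proof.
move=> A0 B0; have A1 : 0 < A + 1 by lra.
exists (B / (A + 1)); first exact: divr_gt0.
by move=> m m0; rewrite ler_pdivlMr// => h; nra.
Qed.

(* [HT] is the squared norm of the tangential part and [BT] its value under the second variation. *)
Lemma almost_tangent_coercive (c g lg p K2 m k BT B HT : R) :
  0 < c -> 0 <= g -> 0 <= lg -> 1 < p -> 0 <= m ->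
  `|k| <= K2 * m -> c * HT <= BT -> BT = B + k ^+ 2 * ((p - 1) * lg) ->
  m <= 2 * HT + 2 * (k ^+ 2 * g) ->
  (c * g + (p - 1) * lg) * K2 ^+ 2 * m <= c / 8 -> 3 * c / 8 * m <= B.
Proof.
move=> c0 g0 lg0 p1 m0 hk hBT EB hm hs.
have pl : 0 <= (p - 1) * lg by apply: mulr_ge0 => //; lra.
set q := (p - 1) * lg in pl EB hs.
have k2 : k ^+ 2 <= K2 ^+ 2 * m ^+ 2.
  by rewrite -real_normK ?num_real// -exprMn lerXn2r ?nnegrE// (le_trans _ hk).
have cg : 0 <= c * g by rewrite mulr_ge0// ltW.
have h1 : k ^+ 2 * (c * g + q) <= K2 ^+ 2 * m ^+ 2 * (c * g + q).
  by rewrite ler_wpM2r// addr_ge0.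
have h2 : K2 ^+ 2 * m ^+ 2 * (c * g + q) <= c / 8 * m.
  have -> : K2 ^+ 2 * m ^+ 2 * (c * g + q) = (c * g + q) * K2 ^+ 2 * m * m by ring.
  exact: ler_wpM2r.
have h3 : c * m <= 2 * (c * HT) + 2 * (k ^+ 2 * (c * g)).
  have -> : 2 * (c * HT) + 2 * (k ^+ 2 * (c * g)) = c * (2 * HT + 2 * (k ^+ 2 * g)) by ring.
  by rewrite ler_wpM2l// ltW.
lra.
Qed.

(** By the Euler-Lagrange equation the difference is [Q(xi) + 2 lg <nl ug, xi>]; convexity and
    [lg >= 0] make the second term non-positive. *)
Lemma ground_state_energy_upper bc a b V p om ug ug' xi xi' : a < b -> 1 < p ->
  bounded_potential R a b V -> - lambda0 bc a b V < om ->
  is_ground_state R bc a b V p om ug ug' ->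
  inX bc a b xi xi' -> onS a b p (fun x => ug x + xi x) ->
  Qf a b V om (fun x => ug x + xi x) (fun x => ug' x + xi' x) - Qf a b V om ug ug'
    <= Qf a b V om xi xi'.
Proof.
move=> ab hp hV hom hg hxi hS; have [gX gS _] := hg.
have [wg _] := gX; have [wxi _] := hxi.
rewrite QfD// ?(ltW ab)// (euler_lagrange R bc _ _ _ p)//.
have lg0 := Qf_ge0 R bc a b V om _ _ ab hV hom gX.
have := intpow_convex R a b p _ _ _ _ ab hp wg wxi.
rewrite gS hS => h.
have : ip a b (fun x => nl p (ug x)) xi <= 0 by nra.
nra.
Qed.

(** The two conclusions share the expansion of the constraint and all thresholds. The second allows
    any [w] and any multiplier [l], so it is a gradient inequality on the sphere, independent of the
    flow. *)
Lemma ground_state_local bc a b V p om ug ug' c : a < b -> 1 < p ->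
  bounded_potential R a b V -> - lambda0 bc a b V < om ->
  is_ground_state R bc a b V p om ug ug' -> 0 < c ->
  (forall xi xi', inX bc a b xi xi' -> ip a b (fun x => nl p (ug x)) xi = 0 ->
     c * H1sq a b xi xi' <= Aform a b V om xi xi' xi xi'
       - p * Qf a b V om ug ug' * ip a b (fun x => `|ug x| `^ (p - 1) * xi x) xi) ->
  exists d c1 c2 : R, [/\ 0 < d, 0 < c1, 0 < c2 &
    forall xi xi', inX bc a b xi xi' -> onS a b p (fun x => ug x + xi x) ->
      H1sq a b xi xi' <= d ->
      let u := fun x => ug x + xi x in let u' := fun x => ug' x + xi' x in
      c1 * H1sq a b xi xi' <= Qf a b V om u u' - Qf a b V om ug ug' /\
      forall w w' l, inX bc a b w w' ->
        (forall phi phi', inX bc a b phi phi' ->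
          ip a b w phi = - Aform a b V om u u' phi phi' + l * ip a b (fun x => nl p (u x)) phi) ->
        c2 * H1sq a b xi xi' <= ip a b w w].
Proof.
move=> ab hp hV hom hg c0 hND; have [gX gS gmin] := hg.
have [wg _] := gX; have g2 := wder_memL2 R _ _ _ _ wg.
have ab' := ltW ab.
set lg := Qf a b V om ug ug'.
have lg0 : 0 <= lg by exact: (Qf_ge0 R bc).
have [M M0 gM] := wder_bounded R a b ug ug' ab wg.
have [K K0 hK] := sobolev_sup R a b ab.
have [KQ KQ0 hKQ] := Qf_le R a b V om hV.
have wc : continuous (fun s : R => `|s| `^ (p - 1)).
  by apply: absr_powR_continuous; rewrite subr_gt0.
have [Bd Bd0 hBd] := continuous_bounded_on_segment R _ wc M.
(* Chosen so that [eta <= 1] and [lg * eta <= c / 16]: each Taylor error then costs a fixed fraction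
   of the coercivity constant [3 * c / 8]. *)
pose eta := Num.min 1 (c / (16 * (lg + 1))).
have lg1 : 0 < 16 * (lg + 1) by lra.
have eta0 : 0 < eta by rewrite lt_min ltr01 divr_gt0.
have eta1 : eta <= 1 by rewrite ge_min lexx.
have etalg : lg * eta <= c / 16.
  have : eta <= c / (16 * (lg + 1)) by rewrite ge_min lexx orbT.
  by rewrite ler_pdivlMr//; nra.
have [d1 d10 hd1] := absr_powR_second_order R p M eta hp eta0.
have [d2 d20 hd2] := unif_first_order R (nl p) _ (fun x => is_derive_nl R p x hp)
  (dnl_continuous R p hp) M eta eta0.
pose dd := Num.min d1 d2.
have dd0 : 0 < dd by rewrite lt_min d10 d20.
pose g := H1sq a b ug ug'.
have g0 : 0 <= g by exact: H1sq_ge0.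
(* With [m] the squared [H^1] norm of [xi], [K2 * m] and [K3 * m] will bound [|<nl ug, xi>|] and
   [|<nl u, xi>|], and [C4 * m] the squared [L^2] norm of the test function. *)
pose K2 := p / 2 * Bd + 1.
have pB : 0 <= p * Bd by apply: mulr_ge0 => //; lra.
have K20 : 0 <= K2 by rewrite /K2; lra.
pose K3 := K2 + p * Bd + 1.
have K30 : 0 <= K3 by rewrite /K3; lra.
pose C4 := 2 + 2 * K3 ^+ 2 * (2 * g + 2).
have C40 : 0 < C4.
  have : 0 <= 2 * K3 ^+ 2 * (2 * g + 2).
    apply: mulr_ge0; [apply: mulr_ge0 => //; exact: sqr_ge0|lra].
  by rewrite /C4; lra.
have dd20 : 0 < dd ^+ 2 by rewrite exprn_gt0.
have [e1 e10 he1] := exists_small K _ (ltW K0) dd20.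
have c8 : 0 < c / 8 by lra.
have c16 : 0 < c / 16 by lra.
have A20 : 0 <= (c * g + (p - 1) * lg) * K2 ^+ 2.
  apply: mulr_ge0; last exact: sqr_ge0.
  by apply: addr_ge0; apply: mulr_ge0 => //; lra.
have [e2 e20 he2] := exists_small _ _ A20 c8.
have A30 : 0 <= K3 * KQ by rewrite mulr_ge0// ltW.
have [e3 e30 he3] := exists_small _ _ A30 c16.
(* [e1] makes [xi] pointwise small, [e2] is the threshold of [almost_tangent_coercive], [e3] absorbs
   the product of [<nl u, xi>] with the energy gap, and the bound 1 lets [m ^+ 2] be replaced by
   [m]. *)
exists (Num.min 1 (Num.min e1 (Num.min e2 e3))), (c / 4), ((c / 8) ^+ 2 / C4).
split; [by rewrite !lt_min ltr01 e10 e20 e30|lra|by rewrite divr_gt0// exprn_gt0|].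
move=> xi xi' hxi hS; rewrite !le_min => /and4P[m1 me1 me2 me3] u u'.
set m := H1sq a b xi xi' in m1 me1 me2 me3 *.
have m0 : 0 <= m by exact: H1sq_ge0.
have [wxi _] := hxi; have x2 := wder_memL2 R _ _ _ _ wxi.
have hu : inX bc a b u u' by exact: inXD.
have [wu _] := hu; have u2 := wder_memL2 R _ _ _ _ wu.
have xdd x : a <= x <= b -> `|xi x| <= dd.
  move=> xab; rewrite -(ler_pXn2r (n := 2))// ?nnegrE// ?(ltW dd0)//.
  rewrite real_normK ?num_real//; apply: (le_trans (hK _ _ wxi x xab)).
  exact: he1.
have xd1 x : a <= x <= b -> `|xi x| <= d1.
  by move=> /xdd h; rewrite (le_trans h)// ge_min lexx.
have xd2 x : a <= x <= b -> `|xi x| <= d2.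
  by move=> /xdd h; rewrite (le_trans h)// ge_min lexx orbT.
set k := ip a b (fun x => nl p (ug x)) xi.
pose wt x := `|ug x| `^ (p - 1) * xi x.
pose T := ip a b wt xi.
pose n := ip a b xi xi.
have n0 : 0 <= n by exact: ip_ge0.
have nm : n <= m by rewrite /m /H1sq lerDl ip_ge0.
have wt2 : memL2 a b wt by exact: memL2_weight wg x2.
have iw := memL2_integ_mul R _ _ _ _ wt2 x2.
have ixx := memL2_integ_mul R _ _ _ _ x2 x2.
have ng := memL2_nl R a b p _ _ ab hp wg.
have nu := memL2_nl R a b p _ _ ab hp wu.
have T0 : 0 <= T.
  by apply: Rintegral_nneg => x _; rewrite /wt -mulrA mulr_ge0 ?powR_ge0// -expr2 sqr_ge0.
have TB : T <= Bd * n.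
  rewrite /T /n /ip -Rintegral_scale//; apply: Rintegral_mono => //; first exact: integZ.
  move=> x xab; rewrite /wt -mulrA ler_wpM2r//; first by rewrite -expr2 sqr_ge0.
  by have := hBd _ (gM x xab); rewrite ger0_norm ?powR_ge0.
have k0 : k <= 0.
  have := intpow_convex R a b p _ _ _ _ ab hp wg wxi.
  by rewrite gS hS -/k => h; clear -h hp; nra.
(* Both [ug] and [ug + xi] lie on the sphere, so the second-order upper expansion of the constraint
   bounds its linear term from below. *)
have klow : - (p / 2 * T + eta * n) <= k.
  pose TT x := (p + 1) * (p / 2 * (wt x * xi x) + eta * (xi x * xi x)).
  have iTT0 : integ R a b (fun x => p / 2 * (wt x * xi x) + eta * (xi x * xi x)).
    by apply: integD; exact: integZ.
  have iTT : integ R a b TT by exact: integZ.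
  have := intpow_upper R a b p _ _ _ _ TT ab hp wg wxi iTT.
  rewrite gS hS -/k /TT Rintegral_scale// Rintegral_add; [|exact: integZ..].
  rewrite !Rintegral_scale// -/(ip a b wt xi) -/T -/(ip a b xi xi) -/n.
  have pw x : a <= x <= b -> `|ug x + xi x| `^ (p + 1) - `|ug x| `^ (p + 1)
     - (p + 1) * nl p (ug x) * xi x <=
     (p + 1) * (p / 2 * (wt x * xi x) + eta * (xi x * xi x)).
    move=> xab; apply: (le_trans (hd1 _ _ (gM x xab) (xd1 x xab))).
    by rewrite /wt le_eqVlt; apply/orP; left; apply/eqP; ring.
  by move=> /(_ pw) h; clear -h hp; nra.
have etan : eta * n <= m by clear -eta1 n0 nm; nra.
have pT0 : 0 <= p * T by apply: mulr_ge0 => //; clear -hp; lra.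
have pTm : p * T <= p * Bd * m.
  apply: (@le_trans _ _ (p * (Bd * n))); first by rewrite ler_wpM2l//; clear -hp; lra.
  by rewrite mulrA ler_wpM2l.
have kK2 : `|k| <= K2 * m.
  by rewrite ler0_norm// /K2; clear -klow etan pTm; lra.
have EL := euler_lagrange R bc a b V p om ug ug' xi xi' ab hp hV hom hg hxi.
rewrite -/lg -/k in EL.
set Qx := Qf a b V om xi xi'.
have Qxm : Qx <= KQ * m by apply: (le_trans (ler_norm _)); exact: hKQ.
pose B := Qx - p * lg * T.
have EE : Qf a b V om u u' - lg = Qx + 2 * (lg * k) by rewrite QfD// EL -/lg -/Qx; ring.
(* (ND) is applied to [xT = xi - k ug], which is exactly tangent. *)
have coer : 3 * c / 8 * m <= B.
  have hkg := inXZ R bc a b (- k) _ _ gX; have [wkg _] := hkg.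
  have hT := inXD R bc a b _ _ _ _ ab' hxi hkg; have [wT _] := hT.
  set xT := (fun x => xi x + _) in hT wT; set xT' := (fun x => xi' x + _) in hT wT.
  have xT0 : ip a b (fun x => nl p (ug x)) xT = 0.
    rewrite ipDr//; last exact: memL2Z.
    by rewrite ipZr// ip_nl_self// gS mulr1 -/k subrr.
  have := hND _ _ hT xT0; rewrite -/lg => hBT.
  apply: (almost_tangent_coercive c g lg p K2 m k _ B _ c0 g0 lg0 hp m0 kK2 hBT) => //.
  (* Removing [k ug] lowers both [Q(xi)], by [k ^+ 2 * lg], and [T], by [k ^+ 2]; together they
     leave the correction [k ^+ 2 * ((p - 1) * lg)]. *)
  - rewrite -Qf_Aform QfD// QfZ// AformZr// (AformC R a b V om xi xi' ug ug') EL -/Qx -/lg.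
    have wgx : memL2 a b (fun x => `|ug x| `^ (p - 1) * ug x) by exact: memL2_weight wg g2.
    have wkgx : memL2 a b (fun x => - k * ug x) by exact: memL2Z.
    have wwk : memL2 a b (fun x => - k * (`|ug x| `^ (p - 1) * ug x)) by exact: memL2Z.
    have -> : ip a b (fun x => `|ug x| `^ (p - 1) * xT x) xT =
       ip a b (fun x => wt x + - k * (`|ug x| `^ (p - 1) * ug x)) xT.
      by apply: ip_ext => // x _; rewrite /wt /xT; ring.
    rewrite ipDl//; last exact: wder_memL2 wT.
    rewrite ipZl//; last exact: wder_memL2 wT.
    rewrite xT0 mulr0 addr0 /xT ipDr// ipZr//.
    have -> : ip a b wt ug = k.
      by rewrite /k; apply: Rintegral_ext => x _; rewrite /wt /nl; ring.
    by rewrite -/T /B; ring.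
  - have := H1sqD_le a b _ _ _ _ wT (wderZ R a b k _ _ wg).
    rewrite H1sqZ// -/g.
    have -> : (fun x => xT x + k * ug x) = xi by apply/funext => x; rewrite /xT; ring.
    have -> : (fun x => xT' x + k * ug' x) = xi' by apply/funext => x; rewrite /xT'; ring.
    by rewrite -/m.
  - exact: he2.
have etalgn : lg * (eta * n) <= c / 16 * m.
  rewrite mulrA; apply: (@le_trans _ _ (lg * eta * m)).
    by rewrite ler_wpM2l// mulr_ge0// ltW.
  exact: ler_wpM2r.
have lk : lg * - (p / 2 * T + eta * n) <= lg * k by rewrite ler_wpM2l.
have cm : 0 <= c * m by rewrite mulr_ge0// ltW.
(* Here [E = B + lg * (2 * k + p * T)], and [klow] bounds the last term below by
   [- 2 * lg * eta * n], so [3 * c / 8] drops by at most [c / 8]. *)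
split; first by rewrite EE; rewrite /B in coer; clear -coer lk etalgn cm; lra.
move=> w w' l hw heq.
set s := ip a b (fun x => nl p (u x)) xi.
have [ww _] := hw; have w2 := wder_memL2 R _ _ _ _ ww.
have hs : `|s - k - p * T| <= eta * n.
  apply: (nl_first_order a b p ug ug' xi xi' eta ab hp wg wxi) => x xab.
  exact: hd2 (gM x xab) (xd2 x xab).
have sK3 : `|s| <= K3 * m.
  move: hs; rewrite !ler_norml => /andP[hs1 hs2]; rewrite ler0_norm// in kK2.
  by rewrite /K3; apply/andP; split; clear -hs1 hs2 kK2 pTm pT0 etan k0; lra.
(* [phi = xi - s u] is tangent to the sphere at [u], so the multiplier [l] drops out. *)
have hsu := inXZ R bc a b (- s) _ _ hu; have [wsu _] := hsu.
have hphi := inXD R bc a b _ _ _ _ ab' hxi hsu; have [wphi _] := hphi.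
set phi := (fun x => xi x + _) in hphi wphi.
set phi' := (fun x => xi' x + _) in hphi wphi.
have phi0 : ip a b (fun x => nl p (u x)) phi = 0.
  rewrite ipDr//; last exact: memL2Z.
  by rewrite ipZr// ip_nl_self// hS mulr1 -/s subrr.
have := heq _ _ hphi; rewrite phi0 mulr0 addr0.
rewrite AformDr// AformZr// -Qf_Aform.
set E := Qf a b V om u u' - lg in EE *.
have -> : Qf a b V om u u' = lg + E by rewrite /E; ring.
rewrite /u /u' AformDl// EL -Qf_Aform -/Qx -/u -/u' => ewphi.
have E0 : 0 <= E by rewrite subr_ge0; exact: gmin.
have lk0 : lg * k <= 0 by rewrite mulr_ge0_le0.
have EKQ : E <= KQ * m by rewrite EE; clear -Qxm lk0; lra.
have sE : s * E <= c / 16 * m.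
  apply: (@le_trans _ _ (K3 * m * (KQ * m))).
    apply: (le_trans (ler_norm _)); rewrite normrM (ger0_norm E0).
    exact: ler_pM.
  have -> : K3 * m * (KQ * m) = K3 * KQ * m * m by ring.
  by apply: ler_wpM2r => //; exact: he3.
have lgs : lg * (s - k - p * T) <= lg * (eta * n).
  by rewrite ler_wpM2l// (le_trans (ler_norm _)).
(* The pairing is [B] minus two errors of at most [c / 16 * m] each, which leaves even
   [c / 4 * m]. *)
have big : c / 8 * m <= - ip a b w phi.
  have -> : - ip a b w phi = B - lg * (s - k - p * T) - s * E by rewrite ewphi /B; ring.
  by clear -coer lgs etalgn sE cm; lra.
have phi2 := wder_memL2 R _ _ _ _ wphi.
have su2 := wder_memL2 R _ _ _ _ wsu.
have CS := ip_cauchy_schwarz R a b _ _ w2 phi2.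
have W0 := ip_ge0 R a b w.
have phiC : ip a b phi phi <= C4 * m.
  have h1 := ipD_le a b _ _ x2 su2; rewrite -/phi ip_scale_sq// -/n sqrrN in h1.
  have h2 := ipD_le a b _ _ g2 x2; rewrite -/u -/n in h2.
  have gg : ip a b ug ug <= g by rewrite /g /H1sq lerDl ip_ge0.
  have uu : ip a b u u <= 2 * g + 2 by clear -h2 gg nm m1; lra.
  have s2 : s ^+ 2 <= K3 ^+ 2 * m.
    apply: (@le_trans _ _ ((K3 * m) ^+ 2)).
      by rewrite -real_normK ?num_real// lerXn2r ?nnegrE// mulr_ge0.
    by rewrite exprMn ler_wpM2l ?sqr_ge0// expr2 ler_piMr.
  have su : s ^+ 2 * ip a b u u <= K3 ^+ 2 * m * (2 * g + 2).
    by apply: ler_pM => //; [exact: sqr_ge0|exact: ip_ge0].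
  by rewrite /C4; clear -h1 nm su; lra.
have cm0 : 0 <= c / 8 * m by rewrite mulr_ge0// ltW.
have sq : (c / 8 * m) ^+ 2 <= ip a b w w * (C4 * m).
  apply: (@le_trans _ _ (ip a b w phi ^+ 2)).
    by rewrite -[X in _ <= X]sqrrN lerXn2r ?nnegrE// (le_trans cm0).
  by apply: (le_trans CS); rewrite ler_wpM2l.
have [->|mn0] := eqVneq m 0; first by rewrite mulr0.
have mp : 0 < m by rewrite lt_neqAle eq_sym mn0.
rewrite mulrAC ler_pdivrMr// -(ler_pM2r mp).
by move: sq; rewrite exprMn expr2 => sq; clear -sq; lra.
Qed.

End LocalEstimates.

(** * Differentiating functionals along curves in [H^1] *)

Section Curves.
Variable R : realType.
Implicit Types (a b c x y t s p om : R) (V u v w h : R -> R) (U : R -> R -> R) (F : R -> R).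

Lemma within_continuous_of_eps F (T : R) :
  (forall t, 0 <= t -> forall e : R, 0 < e -> exists2 d : R, 0 < d &
     forall s, 0 <= s -> `|s - t| < d -> `|F s - F t| <= e) ->
  {within `[0, T], continuous F}.
Proof.
move=> H; apply/subspace_continuousP => t; rewrite /= in_itv/= => /andP[t0 _].
apply/cvgrPdist_le => e e0; have [d d0 hd] := H t t0 e e0.
rewrite near_withinE; apply/nbhs_ballP; exists d => //= s ts.
rewrite in_itv/= => /andP[s0 _]; rewrite distrC; apply: hd => //.
by rewrite distrC.
Qed.

Lemma is_derive_of_eps F t (l : R) : 0 < t ->
  (forall e : R, 0 < e -> exists2 d : R, 0 < d &
     forall s, 0 < s -> `|s - t| < d -> s != t -> `|(F s - F t) / (s - t) - l| <= e) ->
  is_derive t (1:R) F l.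
Proof.
move=> t0 H.
have hc : h^-1 *: (F (h *: 1 + t) - F t) @[h --> (0:R)^'] --> l.
  apply/cvgrPdist_le => e e0; have [d d0 hd] := H e e0.
  near=> h.
  have hn0 : h != 0 by near: h; exact: nbhs_dnbhs_neq.
  have hd' : `|h| < d by near: h; exact: (@dnbhs0_lt R R d).
  have ht : `|h| < t by near: h; exact: (@dnbhs0_lt R R t).
  have sh : h + t - t = h by ring.
  rewrite distrC /GRing.scale/= mulr1.
  have := hd (h + t); rewrite sh mulrC; apply => //.
    by move: ht; rewrite ltr_norml => /andP[]; lra.
  by rewrite -subr_eq0 sh.
by split; [apply/cvg_ex; exists l|apply/cvg_lim].
Unshelve. all: by end_near. Qed.

(** Matches the regularity of the flow: differentiable for positive times, continuous up to time
    0. *)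
Lemma MVT_from0 F dF (T : R) : 0 <= T -> {within `[0, T], continuous F} ->
  (forall t, 0 < t -> is_derive t (1:R) F (dF t)) ->
  exists2 t, 0 < t & F T - F 0 = dF t * T.
Proof.
(* For [T = 0] any positive time is a witness. *)
move=> T0 cF hF; have [->|Tn0] := eqVneq T 0; first by exists 1 => //; rewrite subrr mulr0.
have Tp : 0 < T by rewrite lt_neqAle eq_sym Tn0.
have [|t + E] := MVT Tp _ cF (df := dF).
  by move=> t; rewrite in_itv/= => /andP[t0 _]; exact: hF.
by rewrite in_itv/= => /andP[t0 _]; exists t => //; rewrite E subr0.
Qed.

Lemma le_of_derive_le0 F dF (T : R) : 0 <= T -> {within `[0, T], continuous F} ->
  (forall t, 0 < t -> is_derive t (1:R) F (dF t)) -> (forall t, 0 < t -> dF t <= 0) ->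
  F T <= F 0.
Proof.
move=> T0 cF hF dF0; have [t t0 E] := MVT_from0 F dF T T0 cF hF.
by rewrite -subr_le0 E mulr_le0_ge0 ?dF0.
Qed.

Definition H1_continuous_curve a b U U' :=
  (forall t, 0 <= t -> weak_der a b (U t) (U' t)) /\
  (forall t, 0 <= t -> forall e, 0 < e -> exists d, 0 < d /\
     forall s, 0 <= s -> `|s - t| < d ->
       H1sq a b (fun x => U s x - U t x) (fun x => U' s x - U' t x) < e).

Definition H1_derivative a b U U' t w w' :=
  forall e, 0 < e -> exists d, 0 < d /\
    forall s, 0 < s -> `|s - t| < d -> s != t ->
      H1sq a b (fun x => (U s x - U t x) / (s - t) - w x)
               (fun x => (U' s x - U' t x) / (s - t) - w' x) < e.

(** [L] takes a function and its weak derivative, since an element of [H^1] is such a pair;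
    boundedness is squared to match [H1sq]. *)
Definition bounded_linear_functional a b (L : (R -> R) -> (R -> R) -> R) :=
  [/\ exists2 K : R, 0 <= K & forall v v', weak_der a b v v' -> L v v' ^+ 2 <= K * H1sq a b v v',
      forall c v v', weak_der a b v v' -> L (fun x => c * v x) (fun x => c * v' x) = c * L v v' &
      forall v v' w w', weak_der a b v v' -> weak_der a b w w' ->
        L (fun x => v x + w x) (fun x => v' x + w' x) = L v v' + L w w'].

(** Frechet differentiability at time [t] with quadratic remainder: the common interface through
    which [Q] and the [L^(p+1)] integral obtain continuity and a derivative along the curve. *)
Definition quadratic_expansion a b U U' F t (L : (R -> R) -> (R -> R) -> R) :=
  exists K r : R, [/\ 0 <= K, 0 < r & forall s, 0 <= s ->
    let v := fun x => U s x - U t x in let v' := fun x => U' s x - U' t x in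
    H1sq a b v v' <= r -> `|F s - F t - L v v'| <= K * H1sq a b v v'].

Lemma wderB a b u u' v v' : a <= b -> weak_der a b u u' -> weak_der a b v v' ->
  weak_der a b (fun x => u x - v x) (fun x => u' x - v' x).
Proof.
move=> ab hu hv; have := wderD R a b _ _ _ _ hu (wderZ R a b (-1) _ _ hv) ab.
by under eq_fun do rewrite mulN1r; under [X in weak_der _ _ _ X]eq_fun do rewrite mulN1r.
Qed.

Lemma expansion_continuous a b U U' F L t : a <= b -> H1_continuous_curve a b U U' -> 0 <= t ->
  bounded_linear_functional a b L -> quadratic_expansion a b U U' F t L ->
  forall e : R, 0 < e -> exists2 d : R, 0 < d &
    forall s, 0 <= s -> `|s - t| < d -> `|F s - F t| <= e.
Proof.
move=> ab [hU cU] t0 [[Kl Kl0 hL] _ _] [K [r [K0 r0 hF]]] e e0.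
have e2 : 0 < e / 2 by lra.
have e22 : 0 < (e / 2) ^+ 2 by rewrite exprn_gt0.
have [d1 d10 hd1] := exists_small R K _ K0 e2.
have [d2 d20 hd2] := exists_small R Kl _ Kl0 e22.
have m0 : 0 < Num.min r (Num.min d1 d2) by rewrite !lt_min r0 d10 d20.
have [d [d0 hd]] := cU t t0 _ m0.
exists d => // s s0 st; have := hd s s0 st; rewrite !lt_min => /and3P[/ltW h1 /ltW h2 /ltW h3].
have wv := wderB a b _ _ _ _ ab (hU s s0) (hU t t0).
have H0 := H1sq_ge0 R a b (fun x => U s x - U t x) (fun x => U' s x - U' t x).
have := hF s s0 h1; set Lv := L _ _; set m := H1sq a b _ _ in h1 h2 h3 H0 * => hFs.
have Lv2 : `|Lv| <= e / 2.
  rewrite -(ler_pXn2r (n := 2))// ?nnegrE// ?(ltW e2)// real_normK ?num_real//.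
  by apply: (le_trans (hL _ _ wv)); exact: hd2.
have Km : K * m <= e / 2 by exact: hd1.
have -> : F s - F t = (F s - F t - Lv) + Lv by ring.
by apply: (le_trans (ler_normD _ _)); lra.
Qed.

(** The increment is [(s - t) * (w + q)] with [q] small in [H^1]. Linearity extracts [L(w)],
    boundedness handles [L(q)], and the remainder is of order [(s - t) ^+ 2]. *)
Lemma expansion_derive a b U U' F L t w w' : a <= b -> H1_continuous_curve a b U U' -> 0 < t ->
  bounded_linear_functional a b L -> quadratic_expansion a b U U' F t L ->
  weak_der a b w w' -> H1_derivative a b U U' t w w' ->
  is_derive t (1:R) F (L w w').
Proof.
move=> ab [hU cU] t0 [[Kl Kl0 hL] LZ LD] [K [r [K0 r0 hF]]] hw hd.
apply: is_derive_of_eps => // e e0.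
have e2 : 0 < e / 2 by lra.
have e22 : 0 < (e / 2) ^+ 2 by rewrite exprn_gt0.
have [d2 d20 hd2] := exists_small R Kl _ Kl0 e22.
have m0 : 0 < Num.min 1 d2 by rewrite lt_min ltr01 d20.
have [r1 [r10 hr1]] := hd _ m0.
have [r2 [r20 hr2]] := cU t (ltW t0) _ r0.
pose Cw := 2 * (H1sq a b w w' + 1).
have Cw0 : 0 <= Cw by have := H1sq_ge0 R a b w w'; rewrite /Cw; lra.
have KC0 : 0 <= K * Cw by rewrite mulr_ge0.
have [r3 r30 hr3] := exists_small R (K * Cw) _ KC0 e2.
exists (Num.min r1 (Num.min r2 r3)); first by rewrite !lt_min r10 r20 r30.
move=> s s0; rewrite !lt_min => /and3P[s1 s2 s3] st.
have st0 : s - t != 0 by rewrite subr_eq0.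
have hs := hr1 s s0 s1 st.
pose q := fun x => (U s x - U t x) / (s - t) - w x.
pose q' := fun x => (U' s x - U' t x) / (s - t) - w' x.
have wv := wderB a b _ _ _ _ ab (hU s (ltW s0)) (hU t (ltW t0)).
have wq : weak_der a b q q'.
  have := wderB a b _ _ _ _ ab (wderZ R a b (s - t)^-1 _ _ wv) hw.
  by under eq_fun do rewrite mulrC; under [X in weak_der _ _ _ X]eq_fun do rewrite mulrC.
have wwq := wderD R a b _ _ _ _ hw wq ab.
have Ev : (fun x => U s x - U t x) = (fun x => (s - t) * (w x + q x)).
  by apply/funext => x; rewrite /q; field.
have Ev' : (fun x => U' s x - U' t x) = (fun x => (s - t) * (w' x + q' x)).
  by apply/funext => x; rewrite /q'; field.
have := hF s (ltW s0) (ltW (hr2 s (ltW s0) s2)); rewrite /= Ev Ev'.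
rewrite LZ// LD// H1sqZ//.
have := H1sqD_le R a b _ _ _ _ hw wq.
move: hs; rewrite -/q -/q' lt_min => /andP[/ltW q1 /ltW q2].
set m := H1sq a b (fun x => w x + q x) _ => hm hFs.
have mC : m <= Cw by rewrite /Cw; lra.
have m00 : 0 <= m by exact: H1sq_ge0.
have -> : (F s - F t) / (s - t) - L w w' =
   (F s - F t - (s - t) * (L w w' + L q q')) / (s - t) + L q q' by field.
have Lq : `|L q q'| <= e / 2.
  rewrite -(ler_pXn2r (n := 2))// ?nnegrE// ?(ltW e2)// real_normK ?num_real//.
  by apply: (le_trans (hL _ _ wq)); apply: hd2 => //; exact: H1sq_ge0.
have ast : 0 < `|s - t| by rewrite normr_gt0.
have h1 : `|(F s - F t - (s - t) * (L w w' + L q q')) / (s - t)| <= e / 2.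
  rewrite normrM normfV ler_pdivrMr//; apply: (le_trans hFs).
  rewrite -real_normK ?num_real//.
  have -> : K * (`|s - t| ^+ 2 * m) = K * m * `|s - t| * `|s - t| by ring.
  rewrite ler_wpM2r//; apply: (@le_trans _ _ (K * Cw * `|s - t|)).
    by rewrite ler_wpM2r// ler_wpM2l.
  by apply: hr3 => //; exact: ltW.
by apply: (le_trans (ler_normD _ _)); lra.
Qed.

Lemma Aform_functional a b V om u u' : bounded_potential R a b V -> weak_der a b u u' ->
  bounded_linear_functional a b (fun v v' => 2 * Aform a b V om u u' v v').
Proof.
move=> hV hu; split.
- have [K K0 hK] := Aform_bounded R a b V om u u' hV hu.
  exists (4 * K); first by rewrite mulr_ge0.
  move=> v v' /hK h; rewrite exprMn.
  have -> : (2 : R) ^+ 2 = 4 by ring.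
  lra.
- by move=> c v v' hv; rewrite AformZr//; ring.
- by move=> v v' w w' hv hw; rewrite AformDr// mulrDr.
Qed.

Lemma Qf_expansion a b V om U U' t : a <= b -> bounded_potential R a b V ->
  H1_continuous_curve a b U U' -> 0 <= t ->
  quadratic_expansion a b U U' (fun s => Qf a b V om (U s) (U' s)) t
    (fun v v' => 2 * Aform a b V om (U t) (U' t) v v').
Proof.
move=> ab hV [hU _] t0; have [K K0 hK] := Qf_le R a b V om hV.
exists K, 1; split=> //; first exact: ltW.
move=> s s0 v v' _; have wv : weak_der a b v v' by apply: wderB => //; exact: hU.
have -> : Qf a b V om (U s) (U' s) =
    Qf a b V om (fun x => U t x + v x) (fun x => U' t x + v' x).
  by congr Qf; apply/funext => x; rewrite /v /v' addrC subrK.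
rewrite QfD//; last exact: hU.
set A := Aform _ _ _ _ _ _ _ _.
have -> : Qf a b V om (U t) (U' t) + 2 * A + Qf a b V om v v' - Qf a b V om (U t) (U' t) - 2 * A
  = Qf a b V om v v' by ring.
exact: hK.
Qed.

Lemma ip_nl_functional a b p u u' : a < b -> 1 < p -> weak_der a b u u' ->
  bounded_linear_functional a b (fun v _ => (p + 1) * ip a b (fun x => nl p (u x)) v).
Proof.
move=> ab hp hu; have nu := memL2_nl R a b p u u' ab hp hu.
split.
- exists ((p + 1) ^+ 2 * ip a b (fun x => nl p (u x)) (fun x => nl p (u x))).
    by rewrite mulr_ge0 ?sqr_ge0 ?ip_ge0.
  move=> v v' [v2 [v2' _]]; rewrite exprMn -mulrA ler_wpM2l ?sqr_ge0//.
  apply: (le_trans (ip_cauchy_schwarz R a b _ _ nu v2)).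
  by rewrite ler_wpM2l ?ip_ge0// /H1sq lerDl ip_ge0.
- by move=> c v v' [v2 _]; rewrite ipZr//; ring.
- by move=> v v' w w' [v2 _] [w2 _]; rewrite ipDr// mulrDr.
Qed.

Lemma intpow_expansion a b p U U' t : a < b -> 1 < p ->
  H1_continuous_curve a b U U' -> 0 <= t ->
  quadratic_expansion a b U U' (fun s => intpow a b (p + 1) (U s)) t
    (fun v _ => (p + 1) * ip a b (fun x => nl p (U t x)) v).
Proof.
move=> ab hp [hU _] t0.
have [M M0 hM] := wder_bounded R a b _ _ ab (hU t t0).
have [K K0 hK] := sobolev_sup R a b ab.
have [L L0 hL] := absr_powR_quad R p M hp.
have M20 : 0 < M ^+ 2 by rewrite exprn_gt0.
have [r r0 hr] := exists_small R K _ (ltW K0) M20.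
exists L, r; split=> //; first exact: ltW.
move=> s s0 v v' hv; have wv : weak_der a b v v'.
  by apply: wderB; [exact: ltW|exact: hU|exact: hU].
have vM x : a <= x <= b -> `|v x| <= M.
  move=> xab; rewrite -(ler_pXn2r (n := 2))// ?nnegrE// ?(ltW M0)//.
  rewrite real_normK ?num_real//; apply: (le_trans (hK _ _ wv x xab)).
  by apply: hr => //; exact: H1sq_ge0.
have -> : intpow a b (p + 1) (U s) = intpow a b (p + 1) (fun x => U t x + v x).
  by congr intpow; apply/funext => x; rewrite /v addrC subrK.
(* Convexity makes the expansion error nonnegative, so only its upper bound remains to be
   estimated. *)
have lo := intpow_convex R a b p _ _ _ _ ab hp (hU t t0) wv.
have v2 := wder_memL2 R _ _ _ _ wv; have vv := memL2_integ_mul R _ _ _ _ v2 v2.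
have iT : integ R a b (fun x => L * (v x * v x)) by exact: integZ.
have := intpow_upper R a b p _ _ _ _ _ ab hp (hU t t0) wv iT.
rewrite Rintegral_scale// -/(ip a b v v) => up.
have {}up := up (fun x xab => hL (U t x) (v x) (hM x xab) (vM x xab)).
have vm : ip a b v v <= H1sq a b v v' by rewrite /H1sq lerDl ip_ge0.
have Lvm : L * ip a b v v <= L * H1sq a b v v' by rewrite ler_wpM2l// ltW.
rewrite ger0_norm; lra.
Qed.

(** Presents the [H^1] norm as an instance of [Q], so that its continuity along a curve follows from
    [Qf_expansion]. *)
Lemma H1sq_Qf a b u u' : H1sq a b u u' = 2 * Qf a b (fun=> 0) 2^-1 u u'.
Proof.
rewrite /Qf /Q0 /H1sq.
have -> : ip a b (fun x => 0 * u x) u = 0.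
  rewrite /ip (Rintegral_ext R a b _ (fun x => 0 * 0)).
    by rewrite Rintegral_scale ?mul0r//; exact: integ_cst.
  by move=> x _; rewrite !mul0r.
by field.
Qed.

Lemma bounded_potential0 a b : bounded_potential R a b (fun=> 0).
Proof. by split; [exact: measurable_cst|exists 0 => x _; rewrite lexx]. Qed.

(** Feeds the intermediate value theorem in the trapping argument. *)
Lemma H1_distance_continuous a b U U' u u' (T : R) : a <= b -> H1_continuous_curve a b U U' ->
  weak_der a b u u' ->
  {within `[0, T], continuous (fun t => Qf a b (fun=> 0) 2^-1
     (fun x => U t x - u x) (fun x => U' t x - u' x))}.
Proof.
move=> ab [hU cU] hu; apply: within_continuous_of_eps => t t0.
have hc : H1_continuous_curve a b (fun t x => U t x - u x) (fun t x => U' t x - u' x).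
  split; first by move=> s s0; apply: wderB => //; exact: hU.
  move=> s s0 e e0; have [d [d0 hd]] := cU s s0 e e0; exists d; split=> // s1 s10 h1.
  have := hd s1 s10 h1; congr (_ < _); congr H1sq; apply/funext => x; ring.
have bp := bounded_potential0 a b.
apply: (expansion_continuous a b _ _ _ _ t ab hc t0 _ (Qf_expansion a b _ _ _ _ t ab bp hc t0)).
by apply: Aform_functional => //; case: hc => + _; exact.
Qed.

(** Identifies the denominator of [lam], so that testing the equation with [nl p u] cancels
    exactly. *)
Lemma ip_nl_nl a b p u : 1 < p ->
  ip a b (fun x => nl p (u x)) (fun x => nl p (u x)) = intpow a b (2 * p) u.
Proof.
move=> hp; apply: Rintegral_ext => x _; rewrite -expr2 -real_normK ?num_real//.
rewrite /nl normrM (ger0_norm (powR_ge0 _ _)) mulrC mulr_powRB1//; last by lra.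
by rewrite (mulrC 2) powRrM powR_mulrn ?powR_ge0.
Qed.

Lemma ip_add_null a b v w : memL2 a b v -> memL2 a b w -> ip a b v w = 0 -> ip a b w w = 0 ->
  ip a b (fun x => v x + w x) (fun x => v x + w x) = ip a b v v.
Proof.
move=> hv hw vw ww; have hvw := memL2D R a b v w hv hw.
by rewrite ipDl// !ipDr// (ipC R _ _ w v) vw ww !addr0.
Qed.

(** The solution at time 0 agrees with the datum as a function, but their derivatives are separate
    data that may differ on a null set; [H1sq] does not see this difference. *)
Lemma H1sq_ext_der a b u u1 u' u1' v v' : a < b ->
  weak_der a b u u' -> weak_der a b u1 u1' -> weak_der a b v v' ->
  (forall x, a <= x <= b -> u x = u1 x) ->
  H1sq a b (fun x => u x - v x) (fun x => u' x - v' x) =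
  H1sq a b (fun x => u1 x - v x) (fun x => u1' x - v' x).
Proof.
move=> ab hu hu1 hv uu1; have ab' := ltW ab.
have hz := wderB a b _ _ _ _ ab' hu hu1.
have hy := wderB a b _ _ _ _ ab' hu1 hv.
have z2 := wder_memL2_der R _ _ _ _ hz; have y2 := wder_memL2_der R _ _ _ _ hy.
have zz : ip a b (fun x => u' x - u1' x) (fun x => u' x - u1' x) = 0.
  apply: (ip_eq0_of_null_primitive R a b) => // x /andP[ax xb].
  rewrite -(wder_increment R a b _ _ a x hz)// !uu1 ?lexx ?ax ?ab'//; ring.
have yz : ip a b (fun x => u1' x - v' x) (fun x => u' x - u1' x) = 0.
  have := ip_cauchy_schwarz R a b _ _ y2 z2; rewrite zz mulr0 => h.
  by apply/eqP; rewrite -sqrf_eq0 eq_le h sqr_ge0.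
rewrite /H1sq; congr (_ + _).
  by apply: ip_ext => x xab; rewrite uu1.
have -> : (fun x => u' x - v' x) = (fun x => (u1' x - v' x) + (u' x - u1' x)).
  by apply/funext => x; ring.
by rewrite (ip_add_null _ _ _ _ y2 z2 yz zz).
Qed.

End Curves.

(** * Conservation and dissipation along the flow *)

Section Flow.
Variable R : realType.
Variables (bc : bcond) (a b : R) (V : R -> R) (om p : R) (u ux : R -> R -> R).

Lemma flow_curve : flow_solution bc a b V om p u ux -> H1_continuous_curve R a b u ux.
Proof. by case=> h1 [h2 _]; split=> // t /h1 []. Qed.

Lemma flow_derivatives : a < b -> 1 < p -> bounded_potential R a b V ->
  flow_solution bc a b V om p u ux ->
  forall t, 0 < t -> exists w w', [/\ inX bc a b w w',
    forall phi phi', inX bc a b phi phi' -> ip a b w phi =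
      - Aform a b V om (u t) (ux t) phi phi'
      + lam a b V om p (u t) (ux t) * ip a b (fun x => nl p (u t x)) phi,
    is_derive t (1:R) (fun s => intpow a b (p + 1) (u s)) 0 &
    is_derive t (1:R) (fun s => Qf a b V om (u s) (ux s)) (- (2 * ip a b w w))].
Proof.
move=> ab hp hV hf t t0; have hc := flow_curve hf; have ab' := ltW ab.
case: hf => hX [_ [w [wx [hw [hd [_ heq]]]]]].
exists (w t), (wx t); have wX := hw t t0; have [ww _] := wX.
have uX := hX t (ltW t0); have [wu _] := uX.
have w2 := wder_memL2 R _ _ _ _ ww.
have nu := memL2_nl R a b p _ _ ab hp wu.
have nX := inX_nl R bc a b p _ _ ab hp uX.
(* Tangency of the velocity to the sphere, which is what the choice of [lam] is designed for. *)
have wn : ip a b (fun x => nl p (u t x)) (w t) = 0.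
  rewrite ipC; have := heq t t0 _ _ nX.
  rewrite /lam ip_nl_nl//; set A := Aform _ _ _ _ _ _ _ _.
  (* If the denominator of [lam] vanishes, the quotient carries no information, but then
     [nl p (u t)] is null in [L^2] and Cauchy-Schwarz concludes. *)
  have [N0 _|N0 ->] := eqVneq (intpow a b (2 * p) (u t)) 0; last first.
    by rewrite divfK// addNr.
  have := ip_cauchy_schwarz R a b _ _ w2 nu; rewrite ip_nl_nl// N0 mulr0 => h.
  by apply/eqP; rewrite -sqrf_eq0 eq_le h sqr_ge0.
split=> //; first exact: heq.
- have := expansion_derive R a b _ _ _ _ t _ _ ab' hc t0
    (ip_nl_functional R a b p _ _ ab hp wu)
    (intpow_expansion R a b p _ _ t ab hp hc (ltW t0)) ww (hd t t0).
  by rewrite wn mulr0.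
- have := expansion_derive R a b _ _ _ _ t _ _ ab' hc t0
    (Aform_functional R a b V om _ _ hV wu)
    (Qf_expansion R a b V om _ _ t ab' hV hc (ltW t0)) ww (hd t t0).
  (* The equation is tested with the velocity itself; its multiplier term vanishes by [wn]. *)
  have := heq t t0 _ _ wX; rewrite wn mulr0 addr0 => ->.
  by rewrite mulrN opprK.
Qed.

Lemma flow_intpow_continuous (T : R) : a < b -> 1 < p ->
  flow_solution bc a b V om p u ux ->
  {within `[0, T], continuous (fun s => intpow a b (p + 1) (u s))}.
Proof.
move=> ab hp hf; have hc := flow_curve hf; have [hu _] := hc.
apply: within_continuous_of_eps => t t0.
exact: (expansion_continuous R a b _ _ _ _ t (ltW ab) hc t0
  (ip_nl_functional R a b p _ _ ab hp (hu t t0))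
  (intpow_expansion R a b p _ _ t ab hp hc t0)).
Qed.

Lemma flow_Qf_continuous (T : R) : a < b -> bounded_potential R a b V ->
  flow_solution bc a b V om p u ux ->
  {within `[0, T], continuous (fun s => Qf a b V om (u s) (ux s))}.
Proof.
move=> ab hV hf; have hc := flow_curve hf; have [hu _] := hc.
apply: within_continuous_of_eps => t t0.
exact: (expansion_continuous R a b _ _ _ _ t (ltW ab) hc t0
  (Aform_functional R a b V om _ _ hV (hu t t0))
  (Qf_expansion R a b V om _ _ t (ltW ab) hV hc t0)).
Qed.

Lemma flow_intpow_conserved (t : R) : a < b -> 1 < p -> bounded_potential R a b V ->
  flow_solution bc a b V om p u ux -> 0 <= t ->
  intpow a b (p + 1) (u t) = intpow a b (p + 1) (u 0).
Proof.
move=> ab hp hV hf t0; have hd := flow_derivatives ab hp hV hf.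
have cN := flow_intpow_continuous t ab hp hf.
have [|s s0] := MVT_from0 R (fun s => intpow a b (p + 1) (u s)) (fun=> 0) t t0 cN.
  by move=> s /hd [w [w' []]].
by rewrite mul0r => /eqP; rewrite subr_eq0 => /eqP.
Qed.

Lemma flow_Qf_nonincreasing (t : R) : a < b -> 1 < p -> bounded_potential R a b V ->
  flow_solution bc a b V om p u ux -> 0 <= t ->
  Qf a b V om (u t) (ux t) <= Qf a b V om (u 0) (ux 0).
Proof.
move=> ab hp hV hf t0; have hd := flow_derivatives ab hp hV hf.
have cQ := flow_Qf_continuous t ab hV hf.
(* The velocity is only given by an existential at each time, so the derivative is named through the
   derivative operator and evaluated pointwise. *)
pose dQ (s : R) := 'D_(1:R) (fun s => Qf a b V om (u s) (ux s)) s.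
apply: (le_of_derive_le0 R (fun s => Qf a b V om (u s) (ux s)) dQ t) => //.
  by move=> s /hd [w [w' [_ _ _ h]]]; rewrite /dQ derive_val.
move=> s /hd [w [w' [_ _ _ h]]]; rewrite /dQ derive_val oppr_le0.
by rewrite mulr_ge0// ip_ge0.
Qed.

End Flow.

(** * Gronwall estimate and the convergence theorem *)

Lemma exponential_decay (R : realType) (F dF : R -> R) (k T : R) : 0 <= T ->
  {within `[0, T], continuous F} ->
  (forall t : R, 0 < t -> is_derive t (1:R) F (dF t)) ->
  (forall t : R, 0 < t -> dF t <= - (k * F t)) ->
  F T <= F 0 * expR (- (k * T)).
Proof.
move=> T0 cF hF hk.
have dexp (t : R) : is_derive t (1:R) (fun s => expR (k * s)) (expR (k * t) * k).
  have h1 : is_derive t (1:R) (fun s => k * s) k.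
    have := is_deriveZ k (is_derive_id t (1:R)); rewrite /GRing.scale/= mulr1; exact.
  exact: (@is_derive1_comp _ expR (fun s => k * s) t _ _ (is_derive_expR (k * t)) h1).
(* Gronwall: multiplied by the growing exponential, [F] is still nonincreasing. *)
have := le_of_derive_le0 R (fun s => F s * expR (k * s))
  (fun t => (dF t + k * F t) * expR (k * t)) T T0.
rewrite mulr0 expR0 mulr1 expRN => H; rewrite ler_pdivlMr ?expR_gt0//; apply: H.
- move=> x; apply: cvgM; first exact: cF.
  apply: continuous_subspaceT => t; apply: differentiable_continuous.
  by apply/derivable1_diffP; case: (dexp t).
- move=> t t0; have h := is_deriveM (hF t t0) (dexp t).
  by apply: (is_derive_eq h); rewrite /GRing.scale/=; ring.
- move=> t t0; rewrite mulr_le0_ge0 ?expR_ge0//; have := hk t t0; lra.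
Qed.

Theorem mainTheorem20 (R : realType) (bc : bcond) (a b : R) (V : R -> R) (p om : R)
  (ug ug' : R -> R)
  (* Omega = (a,b) a bounded interval *)
  (hab : a < b)
  (* (A1) *)
  (hp : 1 < p)
  (hVm : measurable_fun (Om a b) V)
  (hVb : exists M : R, forall x, a <= x <= b -> 0 <= V x <= M)
  (* (A2) *)
  (hom : - lambda0 bc a b V < om)
  (* u_g is a ground state *)
  (hugX : inX bc a b ug ug')
  (hugS : onS a b p ug)
  (hugmin : forall u u', inX bc a b u u' -> onS a b p u ->
              Qf a b V om ug ug' <= Qf a b V om u u')
  (* (ND) with lambda_g = Q(u_g) *)
  (hND : exists c : R, 0 < c /\
     forall xi xi', inX bc a b xi xi' ->
       ip a b (fun x => nl p (ug x)) xi = 0 ->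
       Aform a b V om xi xi' xi xi'
         - p * Qf a b V om ug ug' * ip a b (fun x => `|ug x| `^ (p - 1) * xi x) xi
       >= c * H1sq a b xi xi')
  (* (R): global well-posedness of the normalized gradient flow *)
  (hR : forall u0 u0', inX bc a b u0 u0' -> onS a b p u0 ->
     (exists u ux, flow_solution bc a b V om p u ux /\
                   forall x, a <= x <= b -> u 0 x = u0 x) /\
     (forall u1 u1x u2 u2x,
        flow_solution bc a b V om p u1 u1x -> flow_solution bc a b V om p u2 u2x ->
        (forall x, a <= x <= b -> u1 0 x = u0 x) ->
        (forall x, a <= x <= b -> u2 0 x = u0 x) ->
        forall t x, 0 <= t -> a <= x <= b -> u1 t x = u2 t x)) :
  exists delta0 : R, 0 < delta0 /\
    forall u0 u0', inX bc a b u0 u0' ->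
      Num.sqrt (H1sq a b (fun x => u0 x - ug x) (fun x => u0' x - ug' x)) <= delta0 ->
      onS a b p u0 ->
      forall u ux, flow_solution bc a b V om p u ux ->
        (forall x, a <= x <= b -> u 0 x = u0 x) ->
        exists C a0 : R, 0 < C /\ 0 < a0 /\
          forall t, 0 < t ->
            Num.sqrt (H1sq a b (fun x => u t x - ug x) (fun x => ux t x - ug' x))
              <= C * expR (- (a0 * t)).
Proof.
have [c [c0 ND]] := hND.
have hV : bounded_potential R a b V by split.
have hg : is_ground_state R bc a b V p om ug ug' by split.
have [d [c1 [c2 [d0 c10 c20 loc]]]] :=
  ground_state_local R bc a b V p om ug ug' c hab hp hV hom hg c0 ND.
have [KQ KQ0 hKQ] := Qf_le R a b V om hV.
have [wg _] := hugX; have ab' := ltW hab.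
set lg := Qf a b V om ug ug' in loc.
have d2 : 0 < d / 2 by lra.
(* Target for the initial energy gap: half of [c1 * d], the least gap possible at squared distance
   [d]. *)
have d4 : 0 < c1 * d / 2 by rewrite divr_gt0// mulr_gt0.
have [e1 e10 he1] := exists_small R KQ _ (ltW KQ0) d4.
have e0 : 0 < Num.min (d / 2) e1 by rewrite lt_min d2 e10.
exists (Num.sqrt (Num.min (d / 2) e1)); split; first by rewrite sqrtr_gt0.
move=> u0 u0' hu0 hdist hS0 u ux hf hinit.
have hc := flow_curve R bc a b V om p u ux hf; have [hu _] := hc.
have [hX _] := hf; have [wu0 _] := hu0.
have ugB v (v' : R -> R) : inX bc a b v v' ->
    inX bc a b (fun x => v x - ug x) (fun x => v' x - ug' x).
  by move=> hv; exact: inXB.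
have sub_add (g v : R -> R) : (fun x => g x + (v x - g x)) = v.
  by apply/funext => x; rewrite addrC subrK.
pose m t := H1sq a b (fun x => u t x - ug x) (fun x => ux t x - ug' x).
have m_ge0 t : 0 <= m t by exact: H1sq_ge0.
have m0 : m 0 <= Num.min (d / 2) e1.
  rewrite /m (H1sq_ext_der R a b _ u0 _ u0')//; last exact: hu.
  by rewrite -ler_sqrt// ltW.
move: m0; rewrite le_min => /andP[m0d m0e].
have NS t : 0 <= t -> onS a b p (u t).
  move=> t0; rewrite /onS (flow_intpow_conserved R bc a b V om p u ux t)//.
  by apply: etrans hS0; apply: Rintegral_ext => x xab; rewrite hinit.
pose E t := Qf a b V om (u t) (ux t) - lg.
have Elow t : 0 <= t -> m t <= d -> c1 * m t <= E t.
  move=> t0 mt; have := loc _ _ (ugB _ _ (hX t t0)).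
  by rewrite !sub_add /= => /(_ (NS t t0) mt) [].
have Eup t : 0 <= t -> E t <= KQ * m t.
  move=> t0; have hxi := ugB _ _ (hX t t0); have [wxi _] := hxi.
  apply: (le_trans _ (le_trans (ler_norm _) (hKQ _ _ wxi))).
  have := ground_state_energy_upper R bc a b V p om ug ug' _ _ hab hp hV hom hg hxi.
  by rewrite !sub_add /= => /(_ (NS t t0)).
have E0small : E 0 <= c1 * d / 2 by apply: (le_trans (Eup 0 (lexx 0))); exact: he1.
have Emono t : 0 <= t -> E t <= E 0.
  by move=> t0; rewrite lerD2r; exact: (flow_Qf_nonincreasing R bc a b V om p u ux t).
(* Otherwise the squared distance would equal [d] at some time, where the energy gap is at least
   [c1 * d]; yet the gap never exceeds its initial value, which is at most half of that. *)
have trapped t : 0 <= t -> m t <= d.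
  move=> t0; rewrite leNgt; apply/negP => mt.
  have cm := H1_distance_continuous R a b u ux ug ug' t ab' hc wg.
  pose f s := Qf a b (fun=> 0) 2^-1 (fun x => u s x - ug x) (fun x => ux s x - ug' x).
  have mf s : m s = 2 * f s by rewrite /m H1sq_Qf.
  (* [f] is half of [m], hence the level [d / 2]. *)
  have fd : Num.min (f 0) (f t) <= d / 2 <= Num.max (f 0) (f t).
    rewrite ge_min le_max; apply/andP; split; apply/orP.
      by left; have := mf 0; lra.
    by right; have := mf t; lra.
  have [s + fs] := IVT t0 cm fd.
  rewrite in_itv/= => /andP[s0 _].
  have ms : m s = d by rewrite mf /f fs; field.
  have := Elow s s0; rewrite ms lexx => /(_ isT) h.
  have := Emono s s0; have : 0 < c1 * d by rewrite mulr_gt0.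
  lra.
have hd := flow_derivatives R bc a b V om p u ux hab hp hV hf.
(* From [E' = - 2 ||w||^2 <= - 2 * c2 * m] and [E <= KQ * m]. *)
pose k := 2 * c2 / KQ.
have k0 : 0 < k by rewrite divr_gt0// mulr_gt0.
have decay t : 0 < t -> E t <= E 0 * expR (- (k * t)).
  move=> t0.
  pose dE (s : R) := 'D_(1:R) (fun s => Qf a b V om (u s) (ux s)) s.
  apply: (exponential_decay R E dE k t (ltW t0)).
  - move=> x; apply: cvgB; last exact: cvg_cst.
    exact: (flow_Qf_continuous R bc a b V om p u ux t hab hV hf).
  - move=> s /hd [w [w' [_ _ _ h]]].
    have := is_deriveB h (is_derive_cst lg s (1:R)).
    by rewrite subr0 /dE derive_val.
  - move=> s s0; have [w [w' [hw heq _ h]]] := hd s s0.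
    rewrite /dE derive_val lerN2.
    have s0' := ltW s0; have := loc _ _ (ugB _ _ (hX s s0')).
    rewrite !sub_add /= => /(_ (NS s s0') (trapped s s0')) [_ /(_ w w' _ hw heq) hw2].
    apply: (@le_trans _ _ (k * (KQ * m s))); first by rewrite ler_wpM2l ?Eup// ltW.
    have -> : k * (KQ * m s) = 2 * (c2 * m s) by rewrite /k; field; rewrite gt_eqF.
    by rewrite ler_wpM2l.
have E00 : 0 <= E 0.
  apply: (le_trans _ (Elow 0 (lexx 0) (trapped 0 (lexx 0)))).
  by rewrite mulr_ge0// ltW.
(* Passing from the squared distance to the distance halves the rate; the [+ 1] keeps the constant
   positive when the initial gap is 0. *)
exists (Num.sqrt (E 0 / c1) + 1), (k / 2).
split; first by rewrite ltr_wpDl// sqrtr_ge0.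
split; first by rewrite divr_gt0.
move=> t t0; have t0' := ltW t0.
have mt : m t <= E 0 / c1 * expR (- (k / 2 * t)) ^+ 2.
  rewrite mulrAC ler_pdivlMr// mulrC; apply: (le_trans (Elow t t0' (trapped t t0'))).
  apply: (le_trans (decay t t0)); rewrite -expRM_natl.
  by have -> : 2%:R * - (k / 2 * t) = - (k * t) by field.
apply: (@le_trans _ _ (Num.sqrt (E 0 / c1) * expR (- (k / 2 * t)))); last first.
  by rewrite ler_wpM2r ?expR_ge0// lerDl.
rewrite -[X in _ <= _ * X](ger0_norm (expR_ge0 _)) -sqrtr_sqr -sqrtrM; last first.
  by rewrite divr_ge0// ltW.
rewrite ler_sqrt// mulr_ge0 ?sqr_ge0// divr_ge0// ltW//.
Qed.
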